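(* Consider the Cauchy problem $$\partial_t f+\Lambda f=\Lambda(f\,\Lambda f)+\partial_x(f\,\partial_x f),\qquad f|_{t=0}=f_0,$$ on $\mathbb{T}$. Assume that the solution $f$ to this problem satisfies $$\sup_{0\le t\le T}\|f(t)\|_{\dot A^1}\le 1 .$$ Then $$\sup_{0\le t\le T}\max_{y}f(y,t)\le\max_{y}f_0(y),$$ $$\inf_{0\le t\le T}\min_{y}f(y,t)\ge\min_{y}f_0(y),$$ and, as a consequence, $$\sup_{0\le t\le T}\|f(t)\|_{L^\infty}\le\|f_0\|_{L^\infty}.$$
   Context: $\mathbb{T}=\mathbb{R}/2\pi\mathbb{Z}$ is the one-dimensional torus. For a function $u$ on $\mathbb{T}$ the Fourier coefficients are $\hat u(n)=\frac{1}{\sqrt{2\pi}}\int_{\mathbb{T}}u(x)e^{-inx}\,dx$, so that $u(x)=\frac{1}{\sqrt{2\pi}}\sum_{n\in\mathbb{Z}}\hat u(n)e^{inx}$. The operator $\Lambda$ is the Fourier multiplier $\widehat{\Lambda u}(n)=|n|\,\hat u(n)$. The Wiener norm is $\|u\|_{\dot A^1}=\sum_{k\in\mathbb{Z}}|k|\,|\hat u(k)|$. The equation conserves the average of the solution, and solutions are assumed to have zero average. Maxima and minima are over $y\in\mathbb{T}$. *)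

(* Defs.v *)
From HB Require Import structures.
From mathcomp Require Import all_boot all_order all_algebra.
From mathcomp Require Import all_classical all_reals all_analysis.
From mathcomp Require Import complex.

Set Implicit Arguments.
Unset Strict Implicit.
Unset Printing Implicit Defensive.

Import Order.TTheory GRing.Theory Num.Theory numFieldNormedType.Exports.

Local Open Scope classical_set_scope.
Local Open Scope ring_scope.
Local Open Scope complex_scope.

(* Functions on the torus T = R/2piZ are 2pi-periodic functions on R; integrals
   over T are taken over the period [-pi, pi]. *)
Definition torus_fun (R : realType) (u : R -> R) : Prop :=
  periodic u (pi *+ 2).

Definition torus_int (R : realType) (u : R -> R) : R :=
  Rintegral (@lebesgue_measure R) `[- pi, pi] u.

Definition torus_cint (R : realType) (u : R -> R[i]) : R[i] :=
  torus_int (fun x => complex.Re (u x)) +i* torus_int (fun x => complex.Im (u x)).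

(* e^(i theta) *)
Definition cis (R : realType) (theta : R) : R[i] := cos theta +i* sin theta.

Definition fourier (R : realType) (u : R -> R) (n : int) : R[i] :=
  ((Num.sqrt (pi *+ 2))^-1)%:C *
  torus_cint (fun x => (u x)%:C * cis (- (n%:~R * x))).

(* A real function is determined by its Fourier coefficients only among
   continuous functions (or up to null sets): the multiplier |n| is therefore
   stated as a relation, Lambda u being the continuous function on the torus
   with Fourier coefficients |n| u^(n), when there is one. *)
Definition is_Lambda (R : realType) (u v : R -> R) : Prop :=
  [/\ continuous v, torus_fun v &
      forall n : int, fourier v n = `|n|%:~R * fourier u n].

Definition wiener1 (R : realType) (u : R -> R) : \bar R :=
  \esum_(k in [set: int]) (`|k|%:~R * complex.Re `|fourier u k|)%:E.

(* For a continuous function on the torus these are attained. *)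
Definition tmax (R : realType) (u : R -> R) : \bar R :=
  ereal_sup (range (EFin \o u)).

Definition tmin (R : realType) (u : R -> R) : \bar R :=
  ereal_inf (range (EFin \o u)).

(* The essential supremum of a periodic function over R is the one over T. *)
Definition Linf (R : realType) (u : R -> R) : \bar R :=
  'N[@lebesgue_measure R]_+oo [EFin \o u]%E.

(* f t x is the value at time t and position x.  The equation is satisfied
   pointwise for 0 < t < T, each of its terms being defined; f is only required
   to be continuous up to t = 0 and t = T. *)
Record is_solution (R : realType) (T : R) (f0 : R -> R) (f : R -> R -> R) :
    Prop := IsSolution {
  sol_torus : forall t : R, 0 <= t <= T -> torus_fun (f t);
  sol_continuous :
    {within `[0, T] `*` [set: R], continuous (fun p : R * R => f p.1 p.2)};
  sol_mean0 : forall t : R, 0 <= t <= T -> torus_int (f t) = 0;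
  sol_initial : f 0 = f0;
  sol_equation : forall t : R, 0 < t < T ->
    exists Lf LfLf : R -> R,
      [/\ is_Lambda (f t) Lf,
          is_Lambda (fun x => f t x * Lf x) LfLf &
          forall x : R,
            [/\ derivable (fun s => f s x) t 1,
                derivable (f t) x 1,
                derivable (fun y => f t y * derive1 (f t) y) x 1 &
                derive1 (fun s => f s x) t + Lf x =
                  LfLf x + derive1 (fun y => f t y * derive1 (f t) y) x]] }.

(* Main.v *)
(* At a point x0 where u is extremal, with u(x0) <> 0, set g = Lambda u and
   w = Lambda (u g).  The terms u(x0) Lambda g (x0) = - u(x0) u''(x0) and
   (u u')'(x0) = u(x0) u''(x0) cancel, so that w(x0) - g(x0) + (u u')'(x0) is
   minus the singular integral of (u(x0) - u) (1 - g) / (1 - cos (. - x0)),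
   up to a positive constant.  Its sign is known because the Wiener bound gives
   |g| <= 1, and the maximum principle follows.

   As u is only known to be differentiable (and u u' too), everything is
   regularised by the Poisson kernel P_r and its images K_r, Q_r under r d/dr
   and (r d/dr)^2: moving the multiplier onto the kernel yields
   int (u(x0) - u) (1 - g) K_r = int w P_r - int g P_r - u(x0) int u Q_r,
   and r tends to 1. *)
From mathcomp Require Import all_boot all_order all_algebra.
From mathcomp Require Import all_classical all_reals all_analysis.
From mathcomp Require Import complex zify ring lra.
Require Import Defs.
Set Implicit Arguments.
Unset Strict Implicit.
Unset Printing Implicit Defensive.
Import Order.TTheory GRing.Theory Num.Theory numFieldNormedType.Exports.
Local Open Scope classical_set_scope.
Local Open Scope ring_scope.

(** The zero average is what keeps [u x0] away from 0: it makes every upper bound [M] of [s * f0]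
    nonnegative, and at a supposed violation [s * f] exceeds [M]. The sign [s], used with the values
    1 and -1, treats maxima and minima together. The equation is not invariant under [f -> - f], but
    [s * (u x0 - u) * (1 - g)] is nonnegative in both cases since [g <= 1]. The function
    [1 - cos (x - x0)] stands in for [(x - x0)^2 / 2]: it is periodic, and it combines the modes 0
    and 1, on which [|n|] acts as 0 and 1, so its integrals against [P_r] and [Q_r] are explicit.
    The limits at [r = 1] come from pointwise comparison with powers of it. The multiplier is moved
    mode by mode. For fixed [r < 1] the weights [r^n], [n r^n], [n^2 r^n] decay geometrically, so
    nothing is asked of the convergence of the Fourier series of [g] or [w]. *)

Section torus_integral.
Context {R : realType}.
Implicit Types (f g h : R -> R) (a b M : R).

(** * Continuity and integration over one period *)

Lemma continuous_fct_cst a : continuous (fun _ : R => a).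
Proof. by move=> x; exact: cst_continuous. Qed.

Lemma continuous_fct_id : continuous (fun x : R => x).
Proof. by move=> x. Qed.

Lemma continuous_fctD f g : continuous f -> continuous g ->
  continuous (fun x => f x + g x).
Proof. by move=> cf cg x; apply: continuousD; [exact: cf|exact: cg]. Qed.

Lemma continuous_fctN f : continuous f -> continuous (fun x => - f x).
Proof. by move=> cf x; apply: continuousN; exact: cf. Qed.

Lemma continuous_fctM f g : continuous f -> continuous g ->
  continuous (fun x => f x * g x).
Proof. by move=> cf cg x; apply: continuousM; [exact: cf|exact: cg]. Qed.

Lemma continuous_fctX f n : continuous f -> continuous (fun x => f x ^+ n).
Proof.
move=> cf; elim: n => [|n IH]; first exact: continuous_fct_cst.
rewrite (_ : (fun x => _) = fun x => f x * f x ^+ n); last first.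
  by apply/funext => x; rewrite exprS.
exact: continuous_fctM.
Qed.

Lemma continuous_fctV f : (forall x, f x != 0) -> continuous f ->
  continuous (fun x => (f x)^-1).
Proof. by move=> f0 cf x; apply: continuousV; [exact: f0|exact: cf]. Qed.

Lemma continuous_fct_norm f : continuous f -> continuous (fun x => `|f x|).
Proof.
move=> cf x; apply: (@continuous_comp _ _ _ f (fun y : R => `|y|)).
  exact: cf.
exact: norm_continuous.
Qed.

Lemma continuous_fct_cos f : continuous f -> continuous (fun x => cos (f x)).
Proof.
move=> cf x; apply: (@continuous_comp _ _ _ f cos); first exact: cf.
exact: continuous_cos.
Qed.

Lemma continuous_fct_sin f : continuous f -> continuous (fun x => sin (f x)).
Proof.
move=> cf x; apply: (@continuous_comp _ _ _ f sin); first exact: cf.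
exact: continuous_sin.
Qed.

Lemma torus_integrable f : continuous f ->
  (@lebesgue_measure R).-integrable `[- pi, pi] (EFin \o f).
Proof.
move=> cf; apply: continuous_compact_integrable; first exact: segment_compact.
by apply: continuous_subspaceT => x; exact: cf.
Qed.

Lemma torus_intD f g : continuous f -> continuous g ->
  torus_int (fun x => f x + g x) = torus_int f + torus_int g.
Proof. by move=> cf cg; apply: RintegralD => //; exact: torus_integrable. Qed.

Lemma torus_intZ a f : continuous f ->
  torus_int (fun x => a * f x) = a * torus_int f.
Proof. by move=> cf; apply: RintegralZl => //; exact: torus_integrable. Qed.

Lemma torus_intN f : continuous f ->
  torus_int (fun x => - f x) = - torus_int f.
Proof.
move=> cf; rewrite -mulN1r -torus_intZ //; congr torus_int.
by apply/funext => x; rewrite mulN1r.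
Qed.

Lemma torus_intB f g : continuous f -> continuous g ->
  torus_int (fun x => f x - g x) = torus_int f - torus_int g.
Proof.
move=> cf cg; rewrite -torus_intN // -torus_intD //.
exact: continuous_fctN.
Qed.

Lemma le_torus_int f g : continuous f -> continuous g ->
  (forall x, f x <= g x) -> torus_int f <= torus_int g.
Proof.
by move=> cf cg fg; apply: le_Rintegral => //; exact: torus_integrable.
Qed.

Lemma norm_torus_int_le f g : continuous f -> continuous g ->
  (forall x, `|f x| <= g x) -> `|torus_int f| <= torus_int g.
Proof.
move=> cf cg fg; rewrite ler_norml -torus_intN //; apply/andP; split.
  apply: le_torus_int => //; first exact: continuous_fctN.
  by move=> x; have := fg x; rewrite ler_norml => /andP[].
by apply: le_torus_int => // x; exact: le_trans (ler_norm _) (fg x).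
Qed.

Lemma torus_int_sum (F : nat -> R -> R) n :
  (forall i, continuous (F i)) ->
  torus_int (fun x => \sum_(i < n) F i x) = \sum_(i < n) torus_int (F i).
Proof.
move=> cF; elim: n => [|n IH].
  rewrite big_ord0 -[RHS](mul0r (torus_int (fun=> 0))) -torus_intZ.
    by congr torus_int; apply/funext => x; rewrite big_ord0 mul0r.
  exact: continuous_fct_cst.
have cS m : continuous (fun x => \sum_(i < m) F i x).
  elim: m => [|m cm].
    by under eq_fun do rewrite big_ord0; exact: continuous_fct_cst.
  by under eq_fun do rewrite big_ord_recr /=; exact: continuous_fctD.
rewrite big_ord_recr /= -IH -torus_intD //.
by congr torus_int; apply/funext => x; rewrite big_ord_recr.
Qed.

Lemma torus_int_cst a : torus_int (fun=> a) = a * (pi *+ 2).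
Proof.
rewrite /torus_int Rintegral_cst //; congr (_ * _).
have pi0 := @pi_gt0 R.
have := lebesgue_measure_itv `[(- pi : R), pi]%R.
rewrite /= lte_fin ifT; last lra.
by move=> ->; rewrite /=; ring.
Qed.

Lemma torus_int_cos (x0 : R) n : torus_int (fun x => cos (n.+1%:R * (x - x0))) = 0.
Proof.
have n0 : n.+1%:R != 0 :> R by [].
have pi0 := @pi_gt0 R.
pose F (x : R) : R := n.+1%:R^-1 * sin (n.+1%:R * (x - x0)).
have dF x : is_derive x (1 : R) F (cos (n.+1%:R * (x - x0))).
  apply: trigger_derive; rewrite /GRing.scale /=.
  by field.
have cF : continuous F.
  by move=> x; apply/differentiable_continuous/derivable1_diffP.
have ccos : continuous (fun x : R => cos (n.+1%:R * (x - x0))).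
  apply/continuous_fct_cos/continuous_fctM; first exact: continuous_fct_cst.
  by apply: continuous_fctD; [exact: continuous_fct_id|exact: continuous_fct_cst].
rewrite /torus_int /Rintegral (@continuous_FTC2 _ _ F).
- rewrite /F /= (_ : n.+1%:R * (pi - x0)
      = n.+1%:R * (- pi - x0) + (pi *+ 2) *+ n.+1); last first.
    by rewrite -[in RHS]mulr_natl; ring.
  by rewrite (periodicn (@sinD2pi R)) subrr.
- lra.
- by apply: continuous_subspaceT => x; exact: ccos.
- split.
  + by move=> x _; exact: ex_derive.
  + by apply: cvg_at_right_filter; exact: cF.
  + by apply: cvg_at_left_filter; exact: cF.
- by move=> x _; rewrite derive1E; exact: derive_val.
Qed.

End torus_integral.

(* Goals are dispatched on their syntactic head: letting unification choose the
   lemma would unfold the kernels below. *)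
Ltac continuity := repeat
  lazymatch goal with
  | |- continuous (fun x => _ + _) => apply: continuous_fctD
  | |- continuous (fun x => - _) => apply: continuous_fctN
  | |- continuous (fun x => _ * _) => apply: continuous_fctM
  | |- continuous (fun x => _ ^+ _) =>
      first [exact: continuous_fct_cst | apply: continuous_fctX]
  | |- continuous (fun x => cos _) => apply: continuous_fct_cos
  | |- continuous (fun x => sin _) => apply: continuous_fct_sin
  | |- continuous (fun x => `|_|) => apply: continuous_fct_norm
  | |- continuous ( *%R ?a) =>
      exact: (continuous_fctM (@continuous_fct_cst _ a) (@continuous_fct_id _))
  | |- continuous (fun x => x) => exact: continuous_fct_id
  | |- continuous (fun _ => ?c) => exact: continuous_fct_cst
  | |- _ => eassumption
  end.

(** * Poisson kernels and finite sums of cosines *)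

Section poisson_kernels.
Context {R : realType}.
Implicit Types (h : R -> R) (r x : R).

(** The kernels are even about [x0], so only cosines centred there meet them, and the computation
    stays real. *)
Definition mode (x0 : R) (n : nat) x : R := cos (n%:R * (x - x0)).

(** This is [|1 - r e^(i (x - x0))|^2]. *)
Definition poissonD r (x0 : R) x : R := 1 - 2 * r * cos (x - x0) + r ^+ 2.

Definition poisson r x0 x : R := (1 - r ^+ 2) / poissonD r x0 x.

(* [poisson1] and [poisson2] are the images of the Poisson kernel [poisson]
   under the first and second power of [r d/dr]. *)
Definition poisson1 r (x0 : R) x : R :=
  ((1 - r ^+ 2) * poisson r x0 x - (1 + r ^+ 2)) / poissonD r x0 x.

Definition poisson2 r (x0 : R) x : R :=
  poisson r x0 x * (2 * (1 - r ^+ 2) * poisson r x0 x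
    - 3 * (1 + r ^+ 2) + poissonD r x0 x) / poissonD r x0 x.

Lemma mode0 x0 x : mode x0 0 x = 1.
Proof. by rewrite /mode mul0r cos0. Qed.

Lemma mode1 x0 x : mode x0 1 x = cos (x - x0).
Proof. by rewrite /mode mul1r. Qed.

Lemma modeSS x0 n x :
  mode x0 n.+2 x = 2 * cos (x - x0) * mode x0 n.+1 x - mode x0 n x.
Proof.
rewrite /mode; move: (x - x0) => y.
rewrite (_ : n.+2%:R * y = n.+1%:R * y + y); last ring.
rewrite (_ : n%:R * y = n.+1%:R * y - y); last ring.
by rewrite cosD cosB; ring.
Qed.

Lemma norm_mode_le1 x0 n x : `|mode x0 n x| <= 1.
Proof. by rewrite ler_norml cos_geN1 cos_le1. Qed.

Lemma continuous_mode x0 n : continuous (mode x0 n).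
Proof. by rewrite /mode; continuity. Qed.

Lemma poissonDE r x0 x :
  poissonD r x0 x = (1 - r) ^+ 2 + 2 * r * (1 - cos (x - x0)).
Proof. by rewrite /poissonD; ring. Qed.

Section summation.
Variables (r x0 : R).
Local Notation c n x := (mode x0 n x).
Local Notation D := (poissonD r x0).

(** By the recurrence [modeSS], the terms satisfy [a_(n+2) = 2 r cos (x - x0) a_(n+1) - r^2 a_n],
    whose coefficients are those of [D]: multiplication by [D] telescopes the sum and leaves its two
    ends. With the weights [n] and [n^2] below, sums of lower weight also survive. *)
Lemma poissonD_sum0 N x :
  D x * (\sum_(n < N.+1) r ^+ n * c n x) =
  1 - r * cos (x - x0) - r ^+ N.+1 * c N.+1 x + r ^+ N.+2 * c N x.
Proof.
elim: N => [|N IH].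
  by rewrite big_ord_recr big_ord0 /= mode0 mode1 /poissonD; ring.
rewrite big_ord_recr mulrDr {}IH (modeSS _ N) /poissonD /=.
rewrite (exprS r N.+2) (exprS r N.+1); ring.
Qed.

Lemma poissonD_sum1 N x :
  D x * (\sum_(n < N.+1) n%:R * r ^+ n * c n x) =
  (1 - r ^+ 2) * ((\sum_(n < N.+1) r ^+ n * c n x) - 1) - r ^+ 2
  - N%:R * r ^+ N.+1 * c N.+1 x + N.+1%:R * r ^+ N.+2 * c N x.
Proof.
elim: N => [|N IH].
  by rewrite !big_ord_recr !big_ord0 /= mode0 mode1 /poissonD; ring.
rewrite big_ord_recr [in RHS]big_ord_recr mulrDr {}IH (modeSS _ N) /poissonD /=.
rewrite (exprS r N.+2) (exprS r N.+1) -(natr1 N.+1) -(natr1 N); ring.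
Qed.

Lemma poissonD_sum2 N x :
  D x * (\sum_(n < N.+1) n%:R ^+ 2 * r ^+ n * c n x) =
  2 * (1 - r ^+ 2) * (\sum_(n < N.+1) n%:R * r ^+ n * c n x)
  - (1 + r ^+ 2) * ((\sum_(n < N.+1) r ^+ n * c n x) - 1) - r ^+ 2
  - N%:R ^+ 2 * r ^+ N.+1 * c N.+1 x + N.+1%:R ^+ 2 * r ^+ N.+2 * c N x.
Proof.
elim: N => [|N IH].
  by rewrite !big_ord_recr !big_ord0 /= mode0 mode1 /poissonD; ring.
rewrite big_ord_recr [in RHS]big_ord_recr [X in _ - _ * (X - 1)]big_ord_recr.
rewrite mulrDr {}IH (modeSS _ N) /poissonD /=.
rewrite (exprS r N.+2) (exprS r N.+1) -(natr1 N.+1) -(natr1 N); ring.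
Qed.

End summation.

Lemma cvg_sqr_geometric r : 0 <= r < 1 ->
  (fun n => n.+1%:R ^+ 2 * r ^+ n) @ \oo --> (0 : R).
Proof.
(* With [s] the fourth root of [r], [(n+1) s^n] is at most the geometric sum [1 + ... + s^n], hence
   bounded. Its square uses up half of [r^n = s^(4n)], and the other half [s^(2n)] tends to 0. *)
move=> /andP[r0 r1]; pose s : R := Num.sqrt (Num.sqrt r).
have s0 : 0 <= s by exact: sqrtr_ge0.
have s4 : s ^+ 2 ^+ 2 = r by rewrite !sqr_sqrtr ?sqrtr_ge0.
have s1 : s < 1 by rewrite -sqrtr1 ltr_sqrt // -sqrtr1 ltr_sqrt.
have Cs n : n.+1%:R * s ^+ n <= (1 - s)^-1.
  rewrite -[leRHS]mul1r ler_pdivlMr ?subr_gt0 //.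
  elim: n => [|n IH]; first by rewrite expr0; lra.
  have sn : 0 <= s ^+ n by exact: exprn_ge0.
  have e := subrX1 s n.+1.
  have : n.+2%:R * s ^+ n.+1 <= \sum_(i < n.+2) s ^+ i.
    rewrite -[n.+2 in leLHS]card_ord mulr_natl -sumr_const.
    apply: ler_sum => i _; apply: ler_wiXn2l => //; first exact: ltW.
    by rewrite -ltnS.
  have e2 := subrX1 s n.+2.
  have : 0 <= s ^+ n.+2 by exact: exprn_ge0.
  nra.
apply: (@squeeze_cvgr _ _ _ _ (fun=> 0) (fun n => (1 - s)^-1 ^+ 2 * (s ^+ 2) ^+ n)).
- apply: nearW => n; apply/andP; split.
    by rewrite mulr_ge0 ?exprn_ge0.
  rewrite -s4 (_ : _ * _ = (n.+1%:R * s ^+ n) ^+ 2 * (s ^+ 2) ^+ n); last first.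
    rewrite -!exprM exprMn -!exprM.
    rewrite -[RHS]mulrA -exprD.
    by congr (_ * _ ^+ _); lia.
  by rewrite ler_wpM2r ?exprn_ge0 // lerXn2r ?nnegrE ?mulr_ge0 ?exprn_ge0
    // invr_ge0; lra.
- exact: cvg_cst.
- rewrite -[X in _ --> X](mulr0 ((1 - s)^-1 ^+ 2)).
  apply: cvgM; first exact: cvg_cst.
  apply: cvg_expr; rewrite ger0_norm ?exprn_ge0 // expr_lt1 //.
Qed.

Section moments.
Variables (r x0 : R).
Hypothesis r01 : 0 <= r < 1.
Local Notation D := (poissonD r x0).

Lemma poissonD_gt0 x : 0 < D x.
Proof.
case/andP: r01 => r0 r1; rewrite poissonDE.
have := cos_le1 (x - x0) => c1.
have : 0 < (1 - r) ^+ 2 by rewrite exprn_gt0 // subr_gt0.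
nra.
Qed.

Lemma poissonD_neq0 x : D x != 0.
Proof. by rewrite gt_eqF // poissonD_gt0. Qed.

Lemma continuous_poissonD : continuous D.
Proof. by rewrite /poissonD; continuity. Qed.

Lemma continuous_poissonDV : continuous (fun x => (D x)^-1).
Proof.
by apply: continuous_fctV; [exact: poissonD_neq0|exact: continuous_poissonD].
Qed.

Lemma continuous_poisson : continuous (poisson r x0).
Proof.
by rewrite /poisson; continuity; exact: continuous_poissonDV.
Qed.

Lemma continuous_poisson1 : continuous (poisson1 r x0).
Proof.
have := continuous_poisson; have := continuous_poissonDV => ? ?.
by rewrite /poisson1; continuity.
Qed.

Lemma continuous_poisson2 : continuous (poisson2 r x0).
Proof.
have := continuous_poisson; have := continuous_poissonD.
by have := continuous_poissonDV => ? ? ?; rewrite /poisson2; continuity.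
Qed.

Lemma continuous_mode_sum (a : nat -> R) N :
  continuous (fun x => \sum_(n < N) a n * mode x0 n x).
Proof.
elim: N => [|N IH].
  by under eq_fun do rewrite big_ord0; exact: continuous_fct_cst.
have cN := @continuous_mode x0 N.
rewrite (_ : (fun x => _) = fun x =>
    (\sum_(n < N) a n * mode x0 n x) + a N * mode x0 N x).
  by continuity.
by apply/funext => x; rewrite big_ord_recr.
Qed.

Lemma torus_int_mode_sum h (a : nat -> R) N : continuous h ->
  \sum_(n < N) a n * torus_int (fun x => h x * mode x0 n x) =
  torus_int (fun x => h x * \sum_(n < N) a n * mode x0 n x).
Proof.
move=> ch; have cm n := @continuous_mode x0 n.
transitivity (\sum_(n < N) torus_int (fun x => a n * (h x * mode x0 n x))).
  by apply: eq_bigr => n _; rewrite torus_intZ //; continuity.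
rewrite -(@torus_int_sum R (fun n x => a n * (h x * mode x0 n x))); last first.
  by move=> n; continuity.
congr torus_int; apply/funext => x; rewrite mulr_sumr.
by apply: eq_bigr => n _; ring.
Qed.

(** Dividing the telescoped identity by [D] leaves the main term [s N] and two tails, each at most
    [(N+1)^2 r^N] times the integral of [|h / D|]. Only sequences of numbers pass to the limit,
    never integrands. *)
Lemma cvg_mode_sum h (a : nat -> R) (e1 e2 : nat -> R) (s : nat -> R -> R)
    (l : R) : continuous h -> (forall N, continuous (s N)) ->
  (forall N, `|e1 N| <= N.+1%:R ^+ 2 * r ^+ N) ->
  (forall N, `|e2 N| <= N.+1%:R ^+ 2 * r ^+ N) ->
  (forall N x, D x * (\sum_(n < N.+1) a n * mode x0 n x) =
     s N x - e1 N * mode x0 N.+1 x + e2 N * mode x0 N x) ->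
  (fun N => torus_int (fun x => h x / D x * s N x)) @ \oo --> l ->
  (fun N => \sum_(n < N.+1) a n * torus_int (fun x => h x * mode x0 n x))
    @ \oo --> l.
Proof.
move=> ch cs be1 be2 DE cl.
have cm n := @continuous_mode x0 n.
have cV := continuous_poissonDV.
pose M := torus_int (fun x => `|h x / D x|).
have dM n : `|torus_int (fun x => h x / D x * mode x0 n x)| <= M.
  apply: norm_torus_int_le => [||x]; [by continuity|by continuity|].
  by rewrite normrM ler_piMr // norm_mode_le1.
have eN N : \sum_(n < N.+1) a n * torus_int (fun x => h x * mode x0 n x) =
   torus_int (fun x => h x / D x * s N x) +
   (e2 N * torus_int (fun x => h x / D x * mode x0 N x)
    - e1 N * torus_int (fun x => h x / D x * mode x0 N.+1 x)).
  rewrite torus_int_mode_sum // -!torus_intZ; [|by continuity|by continuity].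
  have csN := cs N.
  rewrite -torus_intB; [|by continuity|by continuity].
  rewrite -torus_intD; [|by continuity|by continuity].
  congr torus_int; apply/funext => x.
  have D0 := poissonD_neq0 x.
  rewrite -[\sum_(_ < _) _](mulKf D0) DE; ring.
under eq_fun do rewrite eN.
rewrite -[l]addr0; apply: cvgD => //.
apply: norm_cvg0.
apply: (@squeeze_cvgr _ _ _ _ (fun=> 0)
  (fun N => (2 * M) * (N.+1%:R ^+ 2 * r ^+ N))).
- apply: nearW => N; rewrite normr_ge0 /=.
  apply: (le_trans (ler_normB _ _)); rewrite !normrM.
  have := dM N; have := dM N.+1; have := be1 N; have := be2 N.
  set u := N.+1%:R ^+ 2 * _; move=> b2 b1 d1 d0.
  have := ler_pM (normr_ge0 _) (normr_ge0 _) b2 d0.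
  have := ler_pM (normr_ge0 _) (normr_ge0 _) b1 d1.
  lra.
- exact: cvg_cst.
- rewrite -[X in _ --> X](mulr0 (2 * M)).
  by apply: cvgM; [exact: cvg_cst|exact: cvg_sqr_geometric].
Qed.

End moments.

End poisson_kernels.

(** * Moving the multiplier onto the kernel, and explicit moments *)

Section kernel_moments.
Context {R : realType}.
Implicit Types (h v w : R -> R).
Variables (r x0 : R).
Hypothesis r01 : 0 <= r < 1.
Local Notation D := (poissonD r x0).
Local Notation P := (poisson r x0).
Local Notation K := (poisson1 r x0).
Local Notation Q := (poisson2 r x0).
Local Notation J := (@torus_int R).

Lemma torus_int_lin (a b c : R) f g h :
  continuous f -> continuous g -> continuous h ->
  J (fun x => a * f x + b * g x + c * h x) = a * J f + b * J g + c * J h.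
Proof.
move=> cf cg ch.
by rewrite torus_intD ?torus_intD ?torus_intZ //; continuity.
Qed.

Lemma cvg_seq_unique (u v : nat -> R) (a b : R) : u =1 v ->
  u @ \oo --> a -> v @ \oo --> b -> a = b.
Proof.
by move=> /funext -> ua va; exact: (cvg_unique (@Rhausdorff R) ua va).
Qed.

(** The Poisson kernel is [1 + 2 (r cos + r^2 cos 2 + ...)], while the sum gives the mode 0 weight 1
    instead of 1/2: hence the extra [J h]. The weights [n] and [n^2] remove it in the next two
    lemmas. *)
Lemma cvg_sum_modes h : continuous h ->
  (fun N => \sum_(n < N.+1) r ^+ n * J (fun x => h x * mode x0 n x))
    @ \oo --> (J (fun x => h x * P x) + J h) / 2.
Proof.
have /andP[r0 r1] := r01.
move=> ch; have cP := @continuous_poisson R r x0 r01.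
apply: (@cvg_mode_sum R r x0 r01 h _ (fun n => r ^+ n.+1) (fun n => r ^+ n.+2)
  (fun _ x => 1 - r * cos (x - x0))) => //.
- by move=> N; continuity.
- move=> N; rewrite ger0_norm ?exprn_ge0 // exprS ler_wpM2r ?exprn_ge0 //.
  have : 1 <= N.+1%:R :> R by rewrite ler1n.
  nra.
- move=> N; rewrite ger0_norm ?exprn_ge0 // (exprS r N.+1) (exprS r N) mulrA.
  rewrite ler_wpM2r ?exprn_ge0 //.
  have : 1 <= N.+1%:R :> R by rewrite ler1n.
  nra.
- exact: poissonD_sum0.
- rewrite (_ : (fun N => _) = fun=> (J (fun x => h x * P x) + J h) / 2).
    exact: cvg_cst.
  apply/funext => N; rewrite mulrC -torus_intD; [|by continuity|by continuity].
  rewrite -torus_intZ; last by continuity.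
  congr torus_int; apply/funext => x.
  have := poissonD_neq0 x0 r01 x; rewrite /poisson /poissonD => D0.
  by field.
Qed.

Lemma cvg_sum_modes1 h : continuous h ->
  (fun N => \sum_(n < N.+1) n%:R * r ^+ n * J (fun x => h x * mode x0 n x))
    @ \oo --> J (fun x => h x * K x) / 2.
Proof.
have /andP[r0 r1] := r01.
move=> ch; have cP := @continuous_poisson R r x0 r01.
have cV := @continuous_poissonDV R r x0 r01.
pose A N (x : R) := \sum_(n < N.+1) r ^+ n * mode x0 n x.
have cA N : continuous (A N) by exact: continuous_mode_sum.
apply: (@cvg_mode_sum R r x0 r01 h (fun n => n%:R * r ^+ n)
  (fun n => n%:R * r ^+ n.+1)
  (fun n => n.+1%:R * r ^+ n.+2)
  (fun N x => (1 - r ^+ 2) * (A N x - 1) - r ^+ 2)) => //.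
- by move=> N; have := cA N => cAN; continuity.
- move=> N; rewrite normrM !ger0_norm ?exprn_ge0 // (exprS r N) mulrA.
  rewrite ler_wpM2r ?exprn_ge0 //.
  have : 0 <= N%:R :> R by [].
  rewrite -natr1; nra.
- move=> N; rewrite normrM !ger0_norm ?exprn_ge0 //.
  rewrite (exprS r N.+1) (exprS r N) !mulrA.
  rewrite ler_wpM2r ?exprn_ge0 //.
  have : 1 <= N.+1%:R :> R by rewrite ler1n.
  have : r * r <= 1 by nra.
  nra.
- exact: poissonD_sum1.
(* The main term still contains the sum [A N]; its limit is the previous lemma for [h / D]. The
   constants add up to [- (1 - r^2) - r^2 = - 1]. *)
- have ch' : continuous (fun x => h x / D x) by continuity.
  have -> : J (fun x => h x * K x) / 2 = (1 - r ^+ 2) *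
      ((J (fun x => h x / D x * P x) + J (fun x => h x / D x)) / 2)
      + (- 1) * J (fun x => h x / D x).
    rewrite [RHS](_ : _ = (1 - r ^+ 2) / 2 * J (fun x => h x / D x * P x)
      + (- (1 + r ^+ 2) / 2) * J (fun x => h x / D x) + 0 * J h); last by field.
    rewrite -torus_int_lin //; last by continuity.
    have cK := @continuous_poisson1 R r x0 r01.
    rewrite mulrC -torus_intZ; last by continuity.
    congr torus_int; apply/funext => x; rewrite /poisson1.
    by field; exact: poissonD_neq0.
  under eq_fun => N.
    rewrite (_ : J _ = (1 - r ^+ 2) *
       (\sum_(n < N.+1) r ^+ n * J (fun x => h x / D x * mode x0 n x))
       + (- 1) * J (fun x => h x / D x)); first over.
    rewrite torus_int_mode_sum //.
    rewrite -[RHS]addr0 -[X in _ = _ + X](mul0r (J h)).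
    have cAN := cA N.
    rewrite -torus_int_lin //; last by continuity.
    by congr torus_int; apply/funext => x; rewrite -/(A N x); ring.
  apply: cvgD; last exact: cvg_cst.
  by apply: cvgM; [exact: cvg_cst|exact: cvg_sum_modes].
Qed.

Lemma cvg_sum_modes2 h : continuous h ->
  (fun N => \sum_(n < N.+1) n%:R ^+ 2 * r ^+ n * J (fun x => h x * mode x0 n x))
    @ \oo --> J (fun x => h x * Q x) / 2.
Proof.
have /andP[r0 r1] := r01.
move=> ch; have cP := @continuous_poisson R r x0 r01.
have cV := @continuous_poissonDV R r x0 r01.
have cK := @continuous_poisson1 R r x0 r01.
pose A N (x : R) := \sum_(n < N.+1) r ^+ n * mode x0 n x.
have cA N : continuous (A N) by exact: continuous_mode_sum.
pose B N (x : R) := \sum_(n < N.+1) n%:R * r ^+ n * mode x0 n x.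
have cB N : continuous (B N).
  exact: (@continuous_mode_sum _ x0 (fun n => n%:R * r ^+ n)).
apply: (@cvg_mode_sum R r x0 r01 h (fun n => n%:R ^+ 2 * r ^+ n)
  (fun n => n%:R ^+ 2 * r ^+ n.+1)
  (fun n => n.+1%:R ^+ 2 * r ^+ n.+2)
  (fun N x => 2 * (1 - r ^+ 2) * B N x
     - (1 + r ^+ 2) * (A N x - 1) - r ^+ 2)) => //.
- by move=> N; have cAN := cA N; have cBN := cB N; continuity.
- move=> N; rewrite normrM !ger0_norm ?exprn_ge0 // (exprS r N) mulrA.
  rewrite ler_wpM2r ?exprn_ge0 //.
  have : 0 <= N%:R :> R by [].
  rewrite -natr1; nra.
- move=> N; rewrite normrM !ger0_norm ?exprn_ge0 // (exprS r N.+1) (exprS r N) !mulrA.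
  rewrite ler_wpM2r ?exprn_ge0 //.
  have : r * r <= 1 by nra.
  have : 0 <= N.+1%:R ^+ 2 :> R by rewrite exprn_ge0.
  nra.
- exact: poissonD_sum2.
(* Both lower sums are handled by the previous lemmas for [h / D]; the constants add up to
   [(1 + r^2) - r^2 = 1]. *)
- have ch' : continuous (fun x => h x / D x) by continuity.
  have -> : J (fun x => h x * Q x) / 2 = 2 * (1 - r ^+ 2) *
      (J (fun x => h x / D x * K x) / 2) + (- (1 + r ^+ 2)) *
      ((J (fun x => h x / D x * P x) + J (fun x => h x / D x)) / 2)
      + 1 * J (fun x => h x / D x).
    rewrite [RHS](_ : _ = (1 - r ^+ 2) * J (fun x => h x / D x * K x)
      + (- (1 + r ^+ 2) / 2) * J (fun x => h x / D x * P x)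
      + (1 - r ^+ 2) / 2 * J (fun x => h x / D x)); last by field.
    rewrite -torus_int_lin //; [|by continuity|by continuity].
    have cQ := @continuous_poisson2 R r x0 r01.
    rewrite mulrC -torus_intZ; last by continuity.
    congr torus_int; apply/funext => x.
    have := poissonD_neq0 x0 r01 x.
    rewrite /poisson2 /poisson1 /poisson; move: (D x) => d d0.
    by field.
  under eq_fun => N.
    rewrite (_ : J _ = 2 * (1 - r ^+ 2) *
       (\sum_(n < N.+1) n%:R * r ^+ n * J (fun x => h x / D x * mode x0 n x))
       + (- (1 + r ^+ 2)) *
       (\sum_(n < N.+1) r ^+ n * J (fun x => h x / D x * mode x0 n x))
       + 1 * J (fun x => h x / D x)); first over.
    rewrite torus_int_mode_sum //.
    rewrite (torus_int_mode_sum x0 (fun n => n%:R * r ^+ n)) //.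
    have cAN := cA N; have cBN := cB N.
    rewrite -torus_int_lin //; [|by continuity|by continuity].
    by congr torus_int; apply/funext => x; rewrite -/(A N x) -/(B N x); ring.
  apply: cvgD; last by apply: cvgM; exact: cvg_cst.
  by apply: cvgD; apply: cvgM; do ?exact: cvg_cst;
    [exact: cvg_sum_modes1|exact: cvg_sum_modes].
Qed.

(* These hypotheses say that [w] is the image of [v] under the multiplier [|n|],
   which is moved from the function onto the kernel. *)
Lemma torus_int_multiplier v w : continuous v -> continuous w ->
  (forall n, J (fun x => w x * mode x0 n x)
           = n%:R * J (fun x => v x * mode x0 n x)) ->
  J (fun x => w x * P x) = J (fun x => v x * K x) /\
  J (fun x => w x * K x) = J (fun x => v x * Q x).
Proof.
move=> cv cw wv.
(* The case [n = 0] of the hypothesis; it cancels the extra mean in [cvg_sum_modes]. *)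
have Jw : J w = 0.
  have := wv 0%N; rewrite mul0r => <-; congr torus_int; apply/funext => x.
  by rewrite mode0 mulr1.
have two (a b : R) : a / 2 = b / 2 -> a = b by lra.
split; apply: two.
  rewrite -[X in X / 2]addr0 -[X in (_ + X) / _]Jw.
  apply: cvg_seq_unique (cvg_sum_modes cw) (cvg_sum_modes1 cv) => N.
  by apply: eq_bigr => n _; rewrite wv; ring.
apply: cvg_seq_unique (cvg_sum_modes1 cw) (cvg_sum_modes2 cv) => N.
by apply: eq_bigr => n _; rewrite wv; ring.
Qed.

Lemma torus_int_mode n : J (mode x0 n) = (n == 0%N)%:R * (pi *+ 2).
Proof.
case: n => [|n]; last by rewrite torus_int_cos mul0r.
by rewrite mul1r -[RHS]mul1r -torus_int_cst; congr torus_int; apply/funext => x;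
  rewrite mode0.
Qed.

Lemma torus_int_mode1_mode n :
  J (fun x => mode x0 1 x * mode x0 n x) = (n == 1%N)%:R * pi.
Proof.
have cm n := @continuous_mode R x0 n.
case: n => [|n].
  rewrite mul0r -[RHS](mul0r (pi *+ 2)) -(torus_int_mode 1); congr torus_int.
  by apply/funext => x; rewrite mode0 mulr1.
rewrite (_ : (fun x => _) = fun x => 2^-1 * (mode x0 n.+2 x + mode x0 n x)).
  rewrite torus_intZ; last by continuity.
  rewrite torus_intD // !torus_int_mode eqSS.
  by case: (n == 0%N); rewrite /=; field.
by apply/funext => x; rewrite modeSS mode1; field.
Qed.

Lemma torus_int_poisson : J P = pi *+ 2.
Proof.
have e : (J (fun x => 1 * P x) + J (fun=> 1)) / 2 = pi *+ 2.
  apply: cvg_seq_unique (cvg_sum_modes (@continuous_fct_cst R 1))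
    (cvg_cst (pi *+ 2)) => N.
  rewrite big_ord_recl big1 ?addr0 => [|i _] /=.
    by rewrite expr0 mul1r; under eq_fun do rewrite mul1r;
      rewrite torus_int_mode mul1r.
  by under eq_fun do rewrite mul1r; rewrite torus_int_mode mul0r mulr0.
move: e; under eq_fun do rewrite mul1r.
by rewrite torus_int_cst mul1r; lra.
Qed.

(** The multiplier [|n|] kills constants, so the pair [v = 1], [w = 0] is admissible. *)
Lemma torus_int_poisson12 : J K = 0 /\ J Q = 0.
Proof.
have J0 f : J (fun x => 0 * f x) = 0.
  by under eq_fun do rewrite mul0r; rewrite torus_int_cst mul0r.
have [|e1 e2] := torus_int_multiplier (@continuous_fct_cst R 1)
    (@continuous_fct_cst R 0).
  move=> n; rewrite J0; under eq_fun do rewrite mul1r.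
  by rewrite torus_int_mode; case: n => [|n]; rewrite ?mul0r ?mulr0.
move: e1 e2; rewrite !J0.
by under eq_fun do rewrite mul1r; under [in J (fun x => 1 * Q x)]eq_fun do
  rewrite mul1r.
Qed.

(** The mode 1 is fixed by [|n|], so its integrals against the three kernels coincide. Against
    [poisson] it is found by solving [D * P = 1 - r^2] for the cosine, which divides by [r]. *)
Lemma torus_int_cos_kernels : 0 < r ->
  [/\ J (fun x => (1 - cos (x - x0)) * P x) = pi *+ 2 * (1 - r) &
      J (fun x => (1 - cos (x - x0)) * Q x) = - (pi *+ 2 * r)].
Proof.
move=> rgt0; have cm n := @continuous_mode R x0 n.
have cP := @continuous_poisson R r x0 r01.
have cQ := @continuous_poisson2 R r x0 r01.
have c1 := @continuous_fct_cst R 1.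
have ccos : continuous (fun x => cos (x - x0)) by continuity.
have eP : J (fun x => mode x0 1 x * P x) = pi *+ 2 * r.
  rewrite (_ : (fun x => _) = fun x => (1 + r ^+ 2) / (2 * r) * P x
      + (- (1 - r ^+ 2) / (2 * r)) * 1 + 0 * P x).
    rewrite torus_int_lin // torus_int_poisson torus_int_cst.
    by field; rewrite gt_eqF.
  apply/funext => x; rewrite mode1.
  have := poissonD_neq0 x0 r01 x; rewrite /poisson /poissonD => D0.
  by field; rewrite D0 gt_eqF.
have [|e1 e2] := torus_int_multiplier (cm 1%N) (cm 1%N).
  move=> n; rewrite torus_int_mode1_mode.
  by case: n => [|[|n]]; rewrite ?mul0r ?mulr0 ?mul1r.
have lin F : continuous F -> J (fun x => (1 - cos (x - x0)) * F x) =
    J F - J (fun x => mode x0 1 x * F x).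
  move=> cF; rewrite -torus_intB //; last first.
    by have c := cm 1%N; continuity.
  by congr torus_int; apply/funext => x; rewrite mode1; ring.
have [_ Q0] := torus_int_poisson12.
rewrite !lin // torus_int_poisson Q0 -e2 -e1 eP; split; ring.
Qed.

End kernel_moments.

(** * Kernel bounds and limits as [r] tends to 1 *)

Section kernel_estimates.
Context {R : realType}.
Implicit Types (h u : R -> R) (r l a : R).
Variable x0 : R.
Local Notation P r := (poisson r x0).
Local Notation K r := (poisson1 r x0).
Local Notation Q r := (poisson2 r x0).
Local Notation J := (@torus_int R).

Lemma poisson_ge0 r x : 0 <= r < 1 -> 0 <= P r x.
Proof.
move=> r01; have /andP[r0 r1] := r01.
by rewrite divr_ge0 //; [nra|exact: ltW (poissonD_gt0 x0 r01 x)].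
Qed.

(** For [r >= 1/2], [1 - cos <= D]. From [(1 - r)^2 <= D <= (1 + r)^2], the bracket in [poisson2]
    lies between [- 3 (1 + r^2)] and [3 (1 + r)^2 - 3 (1 + r^2) = 6 r]: hence the 6. Errors against
    the signed kernel [Q] thus become errors against the positive kernel [P]. *)
Lemma norm_poisson2_le r x : 2^-1 <= r < 1 ->
  `|Q r x| * (1 - cos (x - x0)) <= 6 * P r x.
Proof.
move=> /andP[r2 r1]; have r01 : 0 <= r < 1 by lra.
have c1 := cos_le1 (x - x0); have cN1 := cos_geN1 (x - x0).
have D0 := poissonD_gt0 x0 r01 x.
have P0 := poisson_ge0 x r01.
have PD : P r x * poissonD r x0 x = 1 - r ^+ 2 by rewrite divfK ?gt_eqF.
have DE := poissonDE r x0 x.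
rewrite /poisson2 2!normrM normfV (ger0_norm P0) (gtr0_norm D0).
set b := `|_|.
rewrite [leLHS](_ : _ = P r x * (b * (1 - cos (x - x0)) / poissonD r x0 x)).
  2: by ring.
rewrite [leRHS]mulrC ler_wpM2l // ler_pdivrMr // {}/b.
move: PD DE D0 P0; set d := poissonD r x0 x; set p := P r x.
move: (cos (x - x0)) c1 cN1 => c c1 cN1 PD DE d0 p0.
have p1 : (1 - r ^+ 2) * p <= (1 + r) ^+ 2.
  rewrite -(ler_pM2r d0) -mulrA PD DE.
  have : 0 <= (1 + r) ^+ 2 * (2 * r * (1 - c)).
    by rewrite !mulr_ge0 ?exprn_ge0 //; lra.
  by rewrite mulrDr; nra.
have p2 : 0 <= (1 - r ^+ 2) * p by apply: mulr_ge0 => //; nra.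
have b6 : `|2 * (1 - r ^+ 2) * p - 3 * (1 + r ^+ 2) + d| <= 6.
  by rewrite ler_norml; apply/andP; split; nra.
have dc : 1 - c <= d by nra.
have c0 : 0 <= 1 - c by lra.
by have := ler_pM c0 (normr_ge0 _) dc b6; nra.
Qed.

(** The numerator of [K] over [D^2] is [2 r ((1 - r)^2 - (1 + r^2) (1 - cos))]. Its negative part,
    the dangerous one, is discarded because [s >= 0]; in the positive part, [2 r (1 - cos) <= D]
    cancels one power of [D]. *)
Lemma poisson1_le r x s M : 0 <= r < 1 -> 0 <= M ->
  0 <= s <= M * (1 - cos (x - x0)) -> s * K r x <= M * (1 - r) * P r x.
Proof.
move=> r01 M0 /andP[s0 sM]; have /andP[r0 r1] := r01.
have c1 := cos_le1 (x - x0).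
have D0 := poissonD_gt0 x0 r01 x.
have D0' := poissonD_neq0 x0 r01 x.
have DE := poissonDE r x0 x.
rewrite /poisson1 /poisson.
move: D0 D0' DE; set d := poissonD r x0 x => D0 D0' DE.
move: (cos (x - x0)) c1 sM DE => c c1 sM DE.
have -> : s * (((1 - r ^+ 2) * ((1 - r ^+ 2) / d) - (1 + r ^+ 2)) / d) =
    s * (2 * r * ((1 - r) ^+ 2 - (1 + r ^+ 2) * (1 - c))) / d / d.
  by rewrite DE; field; rewrite -DE.
rewrite ler_pdivrMr // ler_pdivrMr //.
rewrite [leRHS](_ : _ = M * (1 - r) * (1 - r ^+ 2) * d); last by field.
have c0 : 0 <= 1 - c by lra.
have rc : 0 <= r * s * ((1 + r ^+ 2) * (1 - c)).
  by apply: mulr_ge0; [exact: mulr_ge0|apply: mulr_ge0; [nra|lra]].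
have rM : r * (1 - r) ^+ 2 * s <= r * (1 - r) ^+ 2 * (M * (1 - c)).
  by rewrite ler_wpM2l // mulr_ge0 // exprn_ge0 //; lra.
(* What remains of the difference of the two sides once [rc] and [rM] are used. *)
have Mr : 0 <= M * (1 - r) ^+ 2 * (r * (1 - r) ^+ 2 + (1 - r) ^+ 2
    + 2 * r ^+ 2 * (1 - c)).
  apply: mulr_ge0; first by apply: mulr_ge0; [|nra].
  have := mulr_ge0 r0 (sqr_ge0 (1 - r)); have := sqr_ge0 (1 - r).
  by have := mulr_ge0 (sqr_ge0 r) (c0 : 0 <= 1 - c); lra.
by rewrite DE; nra.
Qed.

Lemma near_left1 (A e : R) : 0 < e ->
  \forall r \near 1^'-, [/\ 2^-1 < r, r < 1 & A * (1 - r) <= e].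
Proof.
move=> e0; have A0 : 0 < `|A| + 1 by rewrite ltr_pwDr.
near=> r; have r1 : r < 1 by near: r; exact: nbhs_left_lt.
split => //; first by near: r; apply: nbhs_left_gt; lra.
have re : 1 - e / (`|A| + 1) < r.
  by near: r; apply: nbhs_left_gt; rewrite ltrBlDr ltrDl divr_gt0.
have : 1 - r <= e / (`|A| + 1) by lra.
rewrite ler_pdivlMr // => h.
have Ar : A * (1 - r) <= `|A| * (1 - r).
  by rewrite ler_wpM2r ?ler_norm //; lra.
lra.
Unshelve. all: by end_near. Qed.

(** The majorant [e + C (1 - cos)] has the explicit integral [2 pi (e + C (1 - r))] against [P]. *)
Lemma cvg_poisson h l : continuous h ->
  (forall e, 0 < e ->
    exists C, forall x, `|h x - l| <= e + C * (1 - cos (x - x0))) ->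
  J (fun x => h x * P r x) @[r --> 1^'-] --> pi *+ 2 * l.
Proof.
move=> ch hl; have pi0 := @pi_gt0 R.
apply/cvgrPdist_le => e e0.
have [C hC] := hl (e / (4 * pi)) (divr_gt0 e0 (mulr_gt0 (ltr0Sn _ _) pi0)).
near=> r.
have [r2 r1 Cr] : [/\ 2^-1 < r, r < 1 & (pi *+ 2 * C) * (1 - r) <= e / 2].
  by near: r; apply: near_left1; exact: divr_gt0.
have r01 : 0 <= r < 1 by lra.
have cP := @continuous_poisson R r x0 r01.
have [c1 _] := @torus_int_cos_kernels R r x0 r01 ltac:(lra).
have cc : continuous (fun x => (1 - cos (x - x0)) * P r x) by continuity.
rewrite distrC -(torus_int_poisson x0 r01) mulrC.
rewrite -torus_intZ // -torus_intB; [|by continuity|by continuity].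
apply: (@le_trans _ _ (J (fun x => e / (4 * pi) * P r x
    + C * ((1 - cos (x - x0)) * P r x)))).
  apply: norm_torus_int_le; [by continuity|by continuity|move=> x].
  rewrite -mulrBl normrM (ger0_norm (poisson_ge0 x r01)) mulrA -mulrDl.
  by rewrite ler_wpM2r ?poisson_ge0.
rewrite torus_intD; [|by continuity|by continuity].
rewrite (torus_intZ _ cP) (torus_intZ _ cc) torus_int_poisson // c1.
rewrite (_ : e / (4 * pi) * (pi *+ 2) = e / 2); last first.
  by move: (lt0r_neq0 pi0); move: pi => p p0; field.
lra.
Unshelve. all: by end_near. Qed.

(* [a] plays the role of the second derivative of [u] at [x0]. *)
Lemma cvg_poisson2 u l a : continuous u ->
  (forall e, 0 < e -> exists2 C, 0 <= C & forall x,
    `|u x - l - a * (1 - cos (x - x0))|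
      <= e * (1 - cos (x - x0)) + C * (1 - cos (x - x0)) ^+ 2) ->
  J (fun x => u x * Q r x) @[r --> 1^'-] --> - (pi *+ 2 * a).
Proof.
move=> cu hu; have pi0 := @pi_gt0 R.
apply/cvgrPdist_le => e e0.
(* The factor 6 of [norm_poisson2_le] and the mass [2 pi] turn [e / (24 pi)] into [e / 2]. *)
have e24 : 0 < e / (24 * pi) by rewrite divr_gt0 // mulr_gt0.
have [C C0 hC] := hu _ e24.
near=> r.
have [r2 r1 Cr] : [/\ 2^-1 < r, r < 1 &
    (12 * pi * C + 2 * pi * `|a|) * (1 - r) <= e / 2].
  by near: r; apply: near_left1; exact: divr_gt0.
have r01 : 0 <= r < 1 by lra.
have cP := @continuous_poisson R r x0 r01.
have cQ := @continuous_poisson2 R r x0 r01.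
have [c1 c2] := @torus_int_cos_kernels R r x0 r01 ltac:(lra).
have [_ Q0] := torus_int_poisson12 x0 r01.
have ccP : continuous (fun x => (1 - cos (x - x0)) * P r x) by continuity.
have ccQ : continuous (fun x => (1 - cos (x - x0)) * Q r x) by continuity.
have cuQ : continuous (fun x => u x * Q r x) by continuity.
pose S := J (fun x => (u x - l - a * (1 - cos (x - x0))) * Q r x).
(* The constant [l] drops out since [Q] has integral 0; the term in [a] is explicit. *)
have SE : J (fun x => u x * Q r x) = S - a * (pi *+ 2 * r).
  rewrite /S [in RHS](_ : (fun x => _) = fun x => 1 * (u x * Q r x) + (- l) * Q r x
    + (- a) * ((1 - cos (x - x0)) * Q r x)); last by apply/funext => x; ring.
  by rewrite torus_int_lin // Q0 c2; ring.
have Sle : `|S| <= e / 2 + 12 * pi * C * (1 - r).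
  apply: (@le_trans _ _ (J (fun x => 6 * (e / (24 * pi)) * P r x
    + 6 * C * ((1 - cos (x - x0)) * P r x)))).
    apply: norm_torus_int_le; [by continuity|by continuity|move=> x].
    have c0 : 0 <= 1 - cos (x - x0) by rewrite subr_ge0 cos_le1.
    rewrite [leLHS]normrM; set d := `|_ - _|; set q := `|Q r x|.
    have := hC x; have := @norm_poisson2_le r x ltac:(lra).
    rewrite -/q -/d => qP dC.
    have := ler_wpM2r (normr_ge0 (Q r x)) dC; rewrite -/q => dq.
    have k0 : 0 <= e / (24 * pi) + C * (1 - cos (x - x0)).
      by rewrite addr_ge0 ?(mulr_ge0 C0) // ltW.
    have := ler_wpM2l k0 qP; move: dq; move: (e / _) (cos _) => e' c; lra.
  rewrite torus_intD; [|by continuity|by continuity].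
  rewrite (torus_intZ _ cP) (torus_intZ _ ccP) torus_int_poisson // c1.
  rewrite le_eqVlt; apply/orP; left; apply/eqP.
  by move: (lt0r_neq0 pi0); move: pi => p p0; field.
have ar : `|a * (pi *+ 2) * (1 - r)| <= 2 * pi * `|a| * (1 - r).
  rewrite !normrM (gtr0_norm (_ : 0 < pi *+ 2)) ?(gtr0_norm (_ : 0 < 1 - r));
    lra.
rewrite SE (_ : _ - _ = - S + - (a * (pi *+ 2) * (1 - r))); last by ring.
apply: le_trans (ler_normD _ _) _; rewrite !normrN; lra.
Unshelve. all: by end_near. Qed.

End kernel_estimates.

(** * From local to global bounds for periodic functions *)

Section periodic_bounds.
Context {R : realType}.
Implicit Types (h u : R -> R).

Lemma periodic_int h (T : R) (m : int) x : periodic h T -> h (x + T *~ m) = h x.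
Proof.
move=> hT; case: m => n; first exact: periodicn.
by rewrite NegzE mulrNz -[in RHS](subrK (T *~ n.+1) x) -pmulrn (periodicn hT).
Qed.

(** The translate is chosen before [h], so that one [y] serves several periodic functions at
    once. *)
Lemma periodic_repr (x0 x : R) : exists2 y, `|y - x0| <= pi &
  forall h, torus_fun h -> h y = h x.
Proof.
have pi0 := @pi_gt0 R.
pose m := Num.floor ((x - x0 + pi) / (pi *+ 2)).
exists (x + (pi *+ 2) *~ (- m)); last by move=> h hT; exact: periodic_int.
have p2 : 0 < pi *+ 2 :> R by lra.
have := Num.Theory.floor_le ((x - x0 + pi) / (pi *+ 2)).
have := Num.Theory.floorD1_gt ((x - x0 + pi) / (pi *+ 2)).
rewrite -/m ltr_pdivrMr // ler_pdivlMr // intrD mulrNz -mulrzl => h1 h2.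
by rewrite ler_norml; apply/andP; split; lra.
Qed.

Lemma torus_fun_cos (x0 : R) : torus_fun (fun x => cos (x - x0)).
Proof.
by move=> x; rewrite -[RHS]cosD2pi; congr cos; ring.
Qed.

Lemma cos_norm (x : R) : cos `|x| = cos x.
Proof. by case: (ger0P x) => // _; rewrite cosN. Qed.

(** Away from [x0], [1 - cos] is bounded below over a period, so a large multiple of its power
    [j.+1] dominates [|h|]. The values [j = 0] and [j = 1] serve continuity and the second-order
    expansion. *)
Lemma periodic_bound h (x0 e : R) j : continuous h -> torus_fun h -> 0 < e ->
  (\forall x \near x0, `|h x| <= e * (1 - cos (x - x0)) ^+ j) ->
  exists2 C, 0 <= C & forall x, `|h x| <=
    e * (1 - cos (x - x0)) ^+ j + C * (1 - cos (x - x0)) ^+ j.+1.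
Proof.
move=> ch hT e0 /nbhs_ballP[d /= d0 hd].
have pi0 := @pi_gt0 R.
have [M M0 hM] : exists2 M : R, 0 <= M & forall y, `|y - x0| <= pi -> `|h y| <= M.
  have [|c _ hc] := @EVT_max R (fun x => `|h x|) (x0 - pi) (x0 + pi) ltac:(lra).
    by apply: continuous_subspaceT => x; exact: continuous_fct_norm.
  exists `|h c| => // y; rewrite ler_norml => /andP[y1 y2].
  by apply: hc; rewrite in_itv /=; lra.
(* Staying below [pi] keeps the cosine decreasing. *)
pose s := Num.min d pi.
have s0 : 0 < s by rewrite lt_min d0.
have spi : s <= pi by rewrite ge_min lexx orbT.
have k0 : 0 < 1 - cos s.
  rewrite subr_gt0 -[ltRHS](@cos0 R) ltr_cos //;
    by rewrite in_itv /=; apply/andP; split; lra.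
pose C := M / (1 - cos s) ^+ j.+1.
have C0 : 0 <= C by rewrite divr_ge0 // exprn_ge0 // ltW.
exists C; first exact: C0.
move=> x.
have [y yx hy] := periodic_repr x0 x.
rewrite -(hy _ hT) -(hy _ (torus_fun_cos x0)).
have c0 : 0 <= 1 - cos (y - x0) by rewrite subr_ge0 cos_le1.
have [ys|ys] := ltP `|y - x0| s.
  apply: (@le_trans _ _ (e * (1 - cos (y - x0)) ^+ j)).
    apply: hd; rewrite /ball /= distrC; apply: lt_le_trans ys _.
    by rewrite ge_min lexx.
  by rewrite lerDl mulr_ge0 ?exprn_ge0.
apply: (le_trans (hM _ yx)).
have kc : 1 - cos s <= 1 - cos (y - x0).
  rewrite lerD2l lerN2 -cos_norm.
  by rewrite leNgt ltr_cos ?in_itv /= -?leNgt //; apply/andP; split; lra.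
have : M <= C * (1 - cos (y - x0)) ^+ j.+1.
  rewrite /C mulrAC ler_pdivlMr ?exprn_gt0 // ler_wpM2l //.
  by rewrite lerXn2r // nnegrE ltW.
have : 0 <= e * (1 - cos (y - x0)) ^+ j by
  apply: mulr_ge0; [exact: ltW|exact: exprn_ge0].
lra.
Qed.

Lemma cvg_poisson_continuous h (x0 : R) : continuous h -> torus_fun h ->
  torus_int (fun x => h x * poisson r x0 x) @[r --> 1^'-] --> pi *+ 2 * h x0.
Proof.
move=> ch hT; apply: (cvg_poisson ch) => e e0.
have hTl : torus_fun (fun x => h x - h x0) by move=> x /=; rewrite hT.
have cl : continuous (fun x => h x - h x0) by continuity.
have [|C _ hC] := @periodic_bound _ x0 e 0 cl hTl e0.
  near=> x; rewrite expr0 mulr1 distrC; near: x.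
  exact: cvgr_dist_le (ch x0) e e0.
by exists C => x; have := hC x; rewrite expr0 mulr1 expr1.
Unshelve. all: by end_near. Qed.

End periodic_bounds.

(** * Second-order expansion at a critical point *)

Section peano.
Context {R : realType}.
Implicit Types (m u p : R -> R) (a b k e : R).
Variable x0 : R.

Lemma near_neg_derive m : derivable m x0 1 -> m x0 = 0 -> derive1 m x0 < 0 ->
  \forall x \near x0, m x * (x - x0) <= 0.
Proof.
move=> dm m0 md.
have : (fun h : R => h^-1 *: (m (h *: 1 + x0) - m x0)) @ 0^' --> derive1 m x0.
  by rewrite derive1E; exact: dm.
move=> /(cvgr_lt (derive1 m x0)) /(_ _ md).
rewrite /nbhs /= => /nbhs_ballP[d /= d0 hd].
apply/nbhs_ballP; exists d => //= x xd.
have [->|xx0] := eqVneq x x0; first by rewrite subrr mulr0.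
have y0 : x - x0 != 0 by rewrite subr_eq0.
have := hd (x - x0); rewrite /ball /= sub0r normrN distrC => /(_ xd y0).
rewrite m0 subr0 /GRing.scale /= mulr1 subrK => /ltW h.
rewrite -(@pmulr_rle0 _ ((x - x0) ^- 2)) ?invr_gt0 ?exprn_even_gt0 //.
by rewrite (_ : _ * _ = (x - x0)^-1 * m x) //; field.
Qed.

Lemma near_local_max p : (forall x, derivable p x 1) ->
  (\forall x \near x0, derive1 p x * (x - x0) <= 0) ->
  \forall x \near x0, p x <= p x0.
Proof.
move=> dp /nbhs_ballP[d /= d0 hd].
have cp : continuous p.
  by move=> x; apply/differentiable_continuous/derivable1_diffP.
have ip x : is_derive x (1 : R) p (derive1 p x).
  by rewrite derive1E; exact: derivableP.
apply/nbhs_ballP; exists d => //= x; rewrite /ball /= => xd.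
have [xx0|xx0|->//] := ltgtP x x0.
  have [c] := MVT xx0 (fun y _ => ip y) (continuous_subspaceT cp).
  rewrite in_itv /= => /andP[c1 c2] e.
  have cb : ball x0 d c by rewrite /ball /= gtr0_norm ?subr_gt0 //;
    move: xd; rewrite gtr0_norm ?subr_gt0 //; lra.
  have := hd _ cb; nra.
have [c] := MVT xx0 (fun y _ => ip y) (continuous_subspaceT cp).
rewrite in_itv /= => /andP[c1 c2] e.
have cb : ball x0 d c by rewrite /ball /= ltr0_norm ?subr_lt0 //;
  move: xd; rewrite ltr0_norm ?subr_lt0 //; lra.
have := hd _ cb; nra.
Qed.

(** Formally [b = u x0 * u''(x0)], so the sign condition says [u''(x0) < k]. The function
    [p = u - k (1 - cos)] should then have a local maximum; [p'] may not be differentiable, but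
    [m = u x0 * u * p'] is at [x0], and it has the sign of [p'] nearby because [u x0 * u > 0]
    there. *)
Lemma near_cos_majorant u b k : (forall x, derivable u x 1) ->
  is_derive x0 (1 : R) (fun x => u x * derive1 u x) b -> derive1 u x0 = 0 ->
  u x0 * (b - k * u x0) < 0 ->
  \forall x \near x0, u x - u x0 <= k * (1 - cos (x - x0)).
Proof.
move=> du db u'0 neg.
have cu : continuous u.
  by move=> x; apply/differentiable_continuous/derivable1_diffP.
have u0 : u x0 != 0 by apply: contraTneq neg => ->; rewrite mul0r ltxx.
have iu x : is_derive x (1 : R) u (derive1 u x).
  by rewrite derive1E; exact: derivableP.
pose p x := u x - k * (1 - cos (x - x0)).
have ip x : is_derive x (1 : R) p (derive1 u x - k * sin (x - x0)).
  by apply: trigger_derive; rewrite /GRing.scale /=; ring.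
pose m x := u x0 * (u x * derive1 u x - k * (u x * sin (x - x0))).
have im : is_derive x0 (1 : R) m (u x0 * (b - k * u x0)).
  by apply: trigger_derive; rewrite /GRing.scale /= subrr sin0 cos0 u'0; ring.
have pos : \forall x \near x0, 0 < u x0 * u x.
  have : (fun x => u x0 * u x) @ x0 --> u x0 * u x0.
    by apply: cvgM; [exact: cvg_cst|exact: cu].
  move=> /(cvgr_gt (u x0 * u x0)); apply.
  by rewrite -expr2 exprn_even_gt0.
have : \forall x \near x0, m x * (x - x0) <= 0.
  apply: near_neg_derive; first exact: ex_derive.
    by rewrite /m u'0 subrr sin0 !mulr0 subr0 mulr0.
  by rewrite derive1E derive_val.
move=> mneg.
have : \forall x \near x0, p x <= p x0.
  apply: near_local_max; first by move=> x; exact: ex_derive.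
  near=> x; rewrite derive1E derive_val.
  have px : 0 < u x0 * u x by near: x.
  have : m x * (x - x0) <= 0 by near: x.
  rewrite /m (_ : _ * _ * _ = u x0 * u x *
    ((derive1 u x - k * sin (x - x0)) * (x - x0))); last by ring.
  by rewrite pmulr_rle0.
apply: filterS => x; rewrite /p subrr cos0 subrr mulr0 subr0; lra.
Unshelve. all: by end_near. Qed.

(* The equation only provides a derivative of [u * u'] at [x0], and [u] is
   divided out of it, which is why [u x0] must not vanish. *)
Lemma near_cos_expansion u b : (forall x, derivable u x 1) ->
  is_derive x0 (1 : R) (fun x => u x * derive1 u x) b -> derive1 u x0 = 0 ->
  u x0 != 0 -> forall e, 0 < e -> \forall x \near x0,
  `|u x - u x0 - b / u x0 * (1 - cos (x - x0))| <= e * (1 - cos (x - x0)).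
Proof.
move=> du db u'0 u0 e e0.
have sq : 0 < u x0 ^+ 2 by rewrite exprn_even_gt0.
have up : \forall x \near x0,
    u x - u x0 <= (b / u x0 + e) * (1 - cos (x - x0)).
  apply: (near_cos_majorant du db u'0).
  by rewrite [ltLHS](_ : _ = - (e * u x0 ^+ 2)) ?oppr_lt0 ?(mulr_gt0 e0 sq) //;
    field.
(* The lower bound is the upper bound for [- u]: the product [u * u'], hence [b], is unchanged,
   while the value at [x0] changes sign. *)
have lo : \forall x \near x0,
    - u x - - u x0 <= (- b / u x0 + e) * (1 - cos (x - x0)).
  have d1N x : derive1 (fun y => - u y) x = - derive1 u x.
    by rewrite !derive1E deriveN.
  apply: (@near_cos_majorant (fun x => - u x) b).
  - by move=> x; apply: derivableN.
  - suff -> : (fun x => - u x * derive1 (fun y => - u y) x)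
        = (fun x => u x * derive1 u x) by [].
    by apply/funext => x; rewrite d1N mulrNN.
  - by rewrite d1N u'0 oppr0.
  - by rewrite [ltLHS](_ : _ = - (e * u x0 ^+ 2)) ?oppr_lt0 ?(mulr_gt0 e0 sq) //;
      field.
near=> x.
have h1 : u x - u x0 <= (b / u x0 + e) * (1 - cos (x - x0)) by near: x.
have h2 : - u x - - u x0 <= (- b / u x0 + e) * (1 - cos (x - x0)) by near: x.
rewrite ler_norml; apply/andP; split; lra.
Unshelve. all: by end_near. Qed.

End peano.

(** * From complex Fourier coefficients to centred cosine modes *)

Section fourier_coefficients.
Context {R : realType}.
Implicit Types (u v : R -> R).
Local Notation J := (@torus_int R).

Lemma fourierE u (n : nat) : continuous u ->
  fourier u n = complex.Complex
    ((Num.sqrt (pi *+ 2))^-1 * J (fun x => u x * cos (n%:R * x)))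
    (- ((Num.sqrt (pi *+ 2))^-1 * J (fun x => u x * sin (n%:R * x)))).
Proof.
move=> cu; rewrite /fourier /torus_cint.
have -> : (fun x => complex.Re ((u x)%:C%C * cis (- (n%:~R * x)))) =
    fun x => u x * cos (n%:R * x).
  by apply/funext => x; rewrite /cis /= cosN mul0r subr0.
have -> : (fun x => complex.Im ((u x)%:C%C * cis (- (n%:~R * x)))) =
    fun x => - (u x * sin (n%:R * x)).
  by apply/funext => x; rewrite /cis /= sinN mul0r addr0 mulrN.
rewrite torus_intN; last by continuity.
by apply/eqP; rewrite eq_complex /= !mul0r subr0 addr0 mulrN !eqxx.
Qed.

Lemma torus_int_modeE u (x0 : R) n : continuous u ->
  J (fun x => u x * mode x0 n x) =
  cos (n%:R * x0) * J (fun x => u x * cos (n%:R * x))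
  + sin (n%:R * x0) * J (fun x => u x * sin (n%:R * x)).
Proof.
move=> cu; rewrite -[RHS]addr0 -[X in _ = _ + X](mul0r (J u)).
rewrite -torus_int_lin; [|by continuity|by continuity|by []].
by congr torus_int; apply/funext => x; rewrite /mode mulrBr cosB; ring.
Qed.

Lemma sqrt2pi_gt0 : 0 < Num.sqrt (pi *+ 2) :> R.
Proof. by rewrite sqrtr_gt0; have := @pi_gt0 R; lra. Qed.

Lemma is_Lambda_mode u v (x0 : R) n : continuous u -> is_Lambda u v ->
  J (fun x => v x * mode x0 n x) = n%:R * J (fun x => u x * mode x0 n x).
Proof.
move=> cu [cv _ /(_ n)]; rewrite !fourierE // => /eqP.
have -> : `|n%:Z|%:~R = (n%:R : R)%:C%C :> R[i].
  by rewrite ger0_norm // -pmulrn rmorph_nat.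
rewrite eq_complex /= => /andP[/eqP h1 /eqP h2].
have s0 := lt0r_neq0 sqrt2pi_gt0.
have si : (Num.sqrt (pi *+ 2))^-1 != 0 :> R by rewrite invr_eq0.
rewrite !torus_int_modeE // mulrDr [n%:R * (cos _ * _)]mulrCA.
rewrite [n%:R * (sin _ * _)]mulrCA.
congr (_ * _ + _ * _); apply: (mulfI si).
  by rewrite h1 mul0r subr0 mulrCA.
by apply: oppr_inj; rewrite h2 mul0r addr0 mulrN mulrCA.
Qed.

Lemma norm_mode_fourier u (x0 : R) (n : nat) : continuous u ->
  `|J (fun x => u x * mode x0 n x)| <=
    Num.sqrt (pi *+ 2) * complex.Re `|fourier u n|.
Proof.
move=> cu; rewrite torus_int_modeE // fourierE // normc_def /=.
set A := J _; set B := J _.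
have cs := cos2Dsin2 (n%:R * x0).
move: (cos _) (sin _) cs => c s cs.
rewrite sqrrN !exprMn -mulrDr sqrtrM ?sqr_ge0 // sqrtr_sqr.
rewrite [`|_^-1|]gtr0_norm ?invr_gt0 ?sqrt2pi_gt0 //.
rewrite mulVKf ?gt_eqF ?sqrt2pi_gt0 //.
rewrite -sqrtr_sqr ler_sqrt ?addr_ge0 ?sqr_ge0 //.
(* Cauchy-Schwarz for the unit vector [(c, s)], through Lagrange's identity. *)
have -> : A ^+ 2 + B ^+ 2 = (c * A + s * B) ^+ 2 + (s * A - c * B) ^+ 2.
  transitivity ((c ^+ 2 + s ^+ 2) * (A ^+ 2 + B ^+ 2)); last by ring.
  by rewrite cs mul1r.
by rewrite lerDl sqr_ge0.
Qed.

Lemma wiener1_sum_le u N : (wiener1 u <= 1)%E ->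
  \sum_(n < N) n%:R * complex.Re `|fourier u n| <= 1.
Proof.
move=> w1; rewrite -lee_fin; apply: le_trans w1; apply: esum_ge.
exists (Posz @` `I_N).
  by split; [exact/finite_image/finite_II|].
rewrite fsbig_image; last by move=> i j _ _ [].
by rewrite -fsbig_ord /= sumEFin lee_fin.
Qed.

(* The frequencies [n >= 1] account for half of the Wiener norm; dropping
   the others only costs a factor 2, which [pi >= 2] absorbs. *)
Lemma Lambda_le1 u v x : continuous u -> is_Lambda u v -> (wiener1 u <= 1)%E ->
  `|v x| <= 1.
Proof.
move=> cu uv w1; have [cv vT _] := uv.
have pi2 := @pi_ge2 R; have pi0 := @pi_gt0 R.
have vP := @cvg_poisson_continuous R v x cv vT.
have Jv : J v = 0.
  have := is_Lambda_mode x 0 cu uv; rewrite mul0r => <-; congr torus_int.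
  by apply/funext => y; rewrite mode0 mulr1.
have bound : \forall r \near 1^'-,
    `|J (fun y => v y * poisson r x y)| <= pi *+ 2.
  near=> r.
  have [r2 r1 _] : [/\ 2^-1 < r, r < 1 & 0 * (1 - r) <= 1].
    by near: r; exact: near_left1.
  have r01 : 0 <= r < 1 by lra.
  have := @cvg_sum_modes R r x r01 v cv; rewrite Jv addr0 => /cvg_norm c.
  suff : `|J (fun y => v y * poisson r x y) / 2| <= pi.
    by rewrite normrM [`|2^-1|]ger0_norm // ler_pdivrMr //; lra.
  apply: (cvgr_to_le c); apply: nearW => N.
  apply: (@le_trans _ _ (Num.sqrt (pi *+ 2) *
      \sum_(n < N.+1) n%:R * complex.Re `|fourier u n|)).
    apply: le_trans (ler_norm_sum _ _ _) _; rewrite mulr_sumr.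
    apply: ler_sum => n _.
    have := norm_mode_fourier x n cu; set F := complex.Re _ => h.
    rewrite (is_Lambda_mode x n cu uv) !normrM normrX (ger0_norm (ler0n _ _)).
    have rn : `|r| ^+ n <= 1 by rewrite exprn_ile1 // ger0_norm; lra.
    rewrite mulrCA [leRHS]mulrCA ler_wpM2l //.
    apply: (le_trans _ h); rewrite -[leRHS]mul1r ler_wpM2r //.
  apply: (@le_trans _ _ (Num.sqrt (pi *+ 2))).
    rewrite -[leRHS]mulr1 ler_wpM2l ?sqrtr_ge0 //; exact: wiener1_sum_le.
  (* [sqrt (2 pi) <= pi] amounts to [2 <= pi]. *)
  rewrite -[leRHS]gtr0_norm // -sqrtr_sqr ler_sqrt ?sqr_ge0 //; nra.
have : `|pi *+ 2 * v x| <= pi *+ 2 by exact: (cvgr_to_le (cvg_norm vP) bound).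
by rewrite normrM [`|pi *+ 2|]gtr0_norm ?ger_pMr //; lra.
Unshelve. all: by end_near. Qed.

End fourier_coefficients.

(** * The inequality at a spatial extremum *)

Section extremum.
Context {R : realType}.
Implicit Types (u g w : R -> R).
Local Notation J := (@torus_int R).

Lemma is_Lambda_kernels u g (r x0 : R) : 0 <= r < 1 -> continuous u ->
  is_Lambda u g ->
  J (fun x => g x * poisson r x0 x) = J (fun x => u x * poisson1 r x0 x) /\
  J (fun x => g x * poisson1 r x0 x) = J (fun x => u x * poisson2 r x0 x).
Proof.
move=> r01 cu ug; have [cg _ _] := ug.
by apply: torus_int_multiplier => // n; exact: is_Lambda_mode.
Qed.

Lemma extremum_derive1 (s x0 : R) u : s != 0 ->
  (forall x, derivable u x 1) -> (forall x, s * u x <= s * u x0) ->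
  derive1 u x0 = 0.
Proof.
move=> s0 du umax.
have x0I : x0 \in `]x0 - 1, x0 + 1[ by rewrite in_itv /=; lra.
have ds x : derivable (s *: u) x 1 by apply: derivableZ.
have d := @derive1_at_max R (s *: u) (x0 - 1) (x0 + 1) x0
  ltac:(lra) (fun x _ => ds x) x0I (fun x _ => umax x).
have : 'D_1 (s *: u) x0 = s *: 'D_1 u x0 by apply: deriveZ.
rewrite (@derive_val _ _ _ _ _ _ _ d) -derive1E /GRing.scale /= => /esym/eqP.
by rewrite mulf_eq0 (negbTE s0) => /eqP.
Qed.

(* The left-hand side is the integral of [s * (u x0 - u) * (1 - g) * poisson1],
   where [poisson1] is positive only at distance [O(1 - r)] from [x0]; there
   the quadratic vanishing of [u x0 - u] wins. *)
Lemma extremum_poisson_bound u g w (s x0 a C : R) :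
  continuous u -> is_Lambda u g -> is_Lambda (fun x => u x * g x) w ->
  (forall x, `|g x| <= 1) -> (forall x, s * u x <= s * u x0) -> 0 <= C ->
  (forall x, `|u x - u x0 - a * (1 - cos (x - x0))|
     <= 1 * (1 - cos (x - x0)) + C * (1 - cos (x - x0)) ^+ 2) ->
  exists M, forall r, 2^-1 < r < 1 ->
    s * (J (fun x => w x * poisson r x0 x) - J (fun x => g x * poisson r x0 x)
      - u x0 * J (fun x => u x * poisson2 r x0 x)) <= M * (1 - r).
Proof.
move=> cu ug vw g1 umax C0 uC; have [cg _ _] := ug.
have cug : continuous (fun x => u x * g x) by continuity.
have pi0 := @pi_gt0 R.
(* The outer 2 bounds [1 - g]; the inner one comes from [(1 - cos)^2 <= 2 (1 - cos)]. *)
pose M : R := 2 * (`|s| * (`|a| + 1 + 2 * C)).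
exists (M * (pi *+ 2)) => r /andP[r2 r1]; have r01 : 0 <= r < 1 by lra.
have cP := @continuous_poisson R r x0 r01.
have cK := @continuous_poisson1 R r x0 r01.
have cQ := @continuous_poisson2 R r x0 r01.
have [e1 e2] := is_Lambda_kernels x0 r01 cu ug.
have [e3 _] := is_Lambda_kernels x0 r01 cug vw.
have [K0 _] := torus_int_poisson12 x0 r01.
(* All three integrals are now against [poisson1], of [u * g], [u] and [g]; since that kernel has
   integral 0, the missing constant term [u x0] may be added to form the product. *)
rewrite e3 e1 -e2.
have cuK : continuous (fun x => u x * poisson1 r x0 x) by continuity.
have cgK : continuous (fun x => g x * poisson1 r x0 x) by continuity.
have cugK : continuous (fun x => u x * g x * poisson1 r x0 x) by continuity.
have -> : s * (J (fun x => u x * g x * poisson1 r x0 x)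
      - J (fun x => u x * poisson1 r x0 x)
      - u x0 * J (fun x => g x * poisson1 r x0 x)) =
    J (fun x => s * (u x0 - u x) * (1 - g x) * poisson1 r x0 x).
  rewrite (_ : (fun x => s * (u x0 - u x) * (1 - g x) * poisson1 r x0 x) =
    fun x => s * u x0 * poisson1 r x0 x + 1 * (s * (u x * g x * poisson1 r x0 x)
     + (- s) * (u x * poisson1 r x0 x)
     + (- (s * u x0)) * (g x * poisson1 r x0 x)) + 0 * u x); last first.
    by apply/funext => x; ring.
  rewrite torus_int_lin //; last by continuity.
  by rewrite torus_int_lin // K0; ring.
apply: (@le_trans _ _ (J (fun x => M * (1 - r) * poisson r x0 x))); last first.
  rewrite torus_intZ // torus_int_poisson //.
  by rewrite le_eqVlt; apply/orP; left; apply/eqP; ring.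
have M0 : 0 <= M.
  by rewrite mulr_ge0 // mulr_ge0 // !addr_ge0 // mulr_ge0.
apply: le_torus_int; [by continuity|by continuity|move=> x].
apply: poisson1_le => //.
have c0 : 0 <= 1 - cos (x - x0) by rewrite subr_ge0 cos_le1.
have c2 : 1 - cos (x - x0) <= 2 by have := cos_geN1 (x - x0); lra.
have := g1 x; rewrite ler_norml => /andP[gl gu].
have s0 : 0 <= s * (u x0 - u x) by have := umax x; lra.
apply/andP; split; first by rewrite mulr_ge0 // subr_ge0.
have uM : s * (u x0 - u x) <= `|s| * ((`|a| + 1 + 2 * C) * (1 - cos (x - x0))).
  apply: le_trans (ler_norm _) _; rewrite normrM ler_wpM2l // distrC.
  have := uC x; move: c0 c2; move: (1 - cos _) => c c0 c2 h.
  have -> : u x - u x0 = (u x - u x0 - a * c) + a * c by ring.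
  apply: le_trans (ler_normD _ _) _; rewrite normrM (ger0_norm c0).
  have : C * c ^+ 2 <= C * (2 * c) by rewrite ler_wpM2l // expr2 ler_wpM2r.
  lra.
by have := ler_pM s0 (_ : 0 <= 1 - g x) uM (_ : 1 - g x <= 2); rewrite /M; lra.
Qed.

Lemma extremum_inequality u g w (s x0 b : R) : s != 0 ->
  torus_fun u -> (forall x, derivable u x 1) ->
  is_Lambda u g -> is_Lambda (fun x => u x * g x) w -> (wiener1 u <= 1)%E ->
  is_derive x0 (1 : R) (fun x => u x * derive1 u x) b ->
  (forall x, s * u x <= s * u x0) -> u x0 != 0 ->
  s * (w x0 - g x0 + b) <= 0.
Proof.
move=> s0 uT du ug vw w1 db umax u0.
have cu : continuous u.
  by move=> x; apply/differentiable_continuous/derivable1_diffP.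
have [cg gT _] := ug; have [cw wT _] := vw.
have u'0 := extremum_derive1 s0 du umax.
pose a := b / u x0.
pose h x := u x - u x0 - a * (1 - cos (x - x0)).
have ch : continuous h by rewrite /h; continuity.
have hT : torus_fun h.
  by move=> x; rewrite /h uT (torus_fun_cos x0 x).
have peano e : 0 < e -> exists2 C, 0 <= C & forall x,
    `|h x| <= e * (1 - cos (x - x0)) + C * (1 - cos (x - x0)) ^+ 2.
  move=> e0.
  have [C C0 hC] := @periodic_bound R h x0 e 1 ch hT e0
    (near_cos_expansion du db u'0 u0 e0).
  by exists C => // x; have := hC x; rewrite expr1.
(* One value of [e] suffices for the quadratic bound; the limit against [poisson2] takes all of
   them. *)
have [C C0 hC] := peano _ ltr01.
have [M hM] := extremum_poisson_bound cu ug vw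
  (fun x => Lambda_le1 x cu ug w1) umax C0 hC.
have lim : s * (J (fun x => w x * poisson r x0 x)
      - J (fun x => g x * poisson r x0 x)
      - u x0 * J (fun x => u x * poisson2 r x0 x)) @[r --> 1^'-]
    --> s * (pi *+ 2 * w x0 - pi *+ 2 * g x0 - u x0 * (- (pi *+ 2 * a))).
  apply: cvgM; first exact: cvg_cst.
  apply: cvgB; last by apply: cvgM; [exact: cvg_cst|exact: cvg_poisson2 cu peano].
  by apply: cvgB; exact: cvg_poisson_continuous.
suff : s * (pi *+ 2 * w x0 - pi *+ 2 * g x0 - u x0 * (- (pi *+ 2 * a))) <= 0.
  rewrite (_ : s * _ = pi *+ 2 * (s * (w x0 - g x0 + b))).
    by rewrite pmulr_rle0 //; have := @pi_gt0 R; lra.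
  by rewrite /a; move: pi => p; field.
apply/ler_addgt0Pr => e e0; rewrite add0r; apply: (cvgr_to_le lim).
near=> r.
have [r2 r1 re] : [/\ 2^-1 < r, r < 1 & M * (1 - r) <= e].
  by near: r; exact: near_left1.
by apply: le_trans (hM r _) re; rewrite r2.
Unshelve. all: by end_near. Qed.

End extremum.

(** * The maximum principle in time *)

Section maximum_principle.
Context {R : realType}.
Variables (T : R) (f0 : R -> R) (f : R -> R -> R).
Hypothesis f_sol : is_solution T f0 f.
Hypothesis f_wiener : forall t, 0 <= t <= T -> (wiener1 (f t) <= 1)%E.

Lemma sol_extremum (s t x : R) : s != 0 -> 0 < t < T ->
  (forall y, s * f t y <= s * f t x) -> f t x != 0 ->
  derivable (fun r => f r x) t 1 /\ s * derive1 (fun r => f r x) t <= 0.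
Proof.
move=> s0 tT fmax ft0; have t0T : 0 <= t <= T by lra.
have [Lf [LfLf [L1 L2 eqn]]] := sol_equation f_sol tT.
have [dt _ dm e] := eqn x; split => //.
have db : is_derive x (1 : R) (fun y => f t y * derive1 (f t) y)
    (derive1 (fun y => f t y * derive1 (f t) y) x).
  by rewrite derive1E; exact: derivableP.
have := extremum_inequality s0 (sol_torus f_sol t0T)
  (fun y => let: And4 _ d _ _ := eqn y in d) L1 L2 (f_wiener t0T) db fmax ft0.
by rewrite addrAC -e addrK.
Qed.

(* Maximum principle for [s * f r x - e * r]: the perturbation makes the time
   derivative of [s * f] positive at the maximum. *)
Lemma sol_bound_lt (s M t : R) : s != 0 -> 0 <= M ->
  (forall x, s * f0 x <= M) -> 0 <= t < T -> forall x, s * f t x <= M.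
Proof.
move=> s0 M0 f0M /andP[t0 tT] x; rewrite leNgt; apply/negP => fM.
have pi0 := @pi_gt0 R.
(* The penalty [e * r] costs at most half of the excess over [M], so the maximum of [F] still
   exceeds [M]. *)
pose e : R := (s * f t x - M) / (2 * T).
have T0 : 0 < T by lra.
have e0 : 0 < e by rewrite divr_gt0 // ?mulr_gt0 // subr_gt0.
have eT : e * T = (s * f t x - M) / 2 by rewrite /e; field; rewrite gt_eqF.
pose F (p : R * R) := s * f p.1 p.2 - e * p.1.
pose A : set (R * R) := `[0, t] `*` `[- pi, pi].
have cF : {within A, continuous F}.
  apply/subspace_continuousP => p Ap.
  have := sol_continuous f_sol; move/(@continuous_subspaceW _ _ A).
  have sub : A `<=` `[0, T] `*` setT.
    by move=> q [/= q1 _]; split => //=; move: q1; rewrite !in_itv /=; lra.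
  move=> /(_ sub)/subspace_continuousP/(_ p Ap) cf.
  apply: cvgB; apply: cvgM; do ?exact: cvg_cst; first exact: cf.
  by apply: cvg_within_filter; exact: cvg_fst.
have cA : compact A by apply: compact_setX; exact: segment_compact.
have red (z : R) : exists2 y, y \in `[- pi, pi] & forall h, torus_fun h -> h y = h z.
  have [y y1 hy] := periodic_repr 0 z; exists y => //.
  by rewrite in_itv /= -ler_norml -[y]subr0.
have [x' x'pi fx'] := red x.
have fper (r : R) : 0 <= r <= T -> forall z z' : R,
    (forall h : R -> R, torus_fun h -> h z' = h z) -> f r z' = f r z.
  by move=> rT z z' zz'; apply: (zz' (f r)); exact: (sol_torus f_sol rT).
have Atx : A (t, x') by split => //=; rewrite in_itv /=; lra.
have [[t' y] /[!inE] -[/= t'A yA] Fmax] :=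
  compact_EVT_max (ex_intro _ _ Atx) cA cF.
have {Fmax} Fmax r z : 0 <= r <= t -> s * f r z - e * r <= s * f t' y - e * t'.
  move=> rt; have [z' z'pi fz'] := red z.
  have <- := fper r ltac:(lra) _ _ fz'.
  by have := Fmax (r, z'); rewrite inE; apply; split; rewrite /= ?in_itv.
move: t'A; rewrite in_itv /= => t't.
have big : M < s * f t' y - e * t'.
  have := Fmax t x ltac:(lra).
  have : e * t <= e * T by rewrite ler_wpM2l ?ltW.
  lra.
have et' : 0 <= e * t' by rewrite mulr_ge0 //; lra.
have t'0 : 0 < t'.
  rewrite lt0r; apply/andP; split; last lra.
  apply/eqP => t'0; move: big; rewrite t'0 (sol_initial f_sol).
  by have := f0M y; lra.
(* Here [0 <= M] is used: [s * f t' y > M] excludes the value 0. *)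
have fy0 : f t' y != 0.
  by apply/eqP => fy0; move: big; rewrite fy0 mulr0; lra.
have ymax z : s * f t' z <= s * f t' y by have := Fmax t' z ltac:(lra); lra.
have [dt dneg] := @sol_extremum s t' y s0 ltac:(lra) ymax fy0.
move: dneg.
have idt : is_derive t' (1 : R) (fun r => f r y) (derive1 (fun r => f r y) t').
  by rewrite derive1E; exact: derivableP.
move: (derive1 _ _) idt => D idt dneg.
(* As [s * D <= 0], the slope of [m] is negative, so just before [t'] the loss of [s * f] is at most
   [e / 2] per unit of time, whereas maximality of [F] requires a loss of at least [e]. *)
pose m r := s * (f r y - f t' y) - e / 2 * (r - t').
have im : is_derive t' (1 : R) m (s * D - e / 2).
  by apply: trigger_derive; rewrite /GRing.scale /=; ring.
have : \forall r \near t', m r * (r - t') <= 0.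
  apply: near_neg_derive; first exact: ex_derive.
    by rewrite /m !subrr !mulr0 subrr.
  by rewrite derive1E derive_val; lra.
move=> /nbhs_ballP[d /= d0 hd].
pose k := Num.min d t' / 2.
have k0 : 0 < k by rewrite divr_gt0 // lt_min d0.
have kd : k < d by rewrite ltr_pdivrMr // gt_min; apply/orP; left; lra.
have kt : k <= t' by rewrite ler_pdivrMr // ge_min; apply/orP; right; lra.
have /hd : ball t' d (t' - k) by rewrite /ball /= opprB addrC subrK gtr0_norm.
have := Fmax (t' - k) y ltac:(lra).
rewrite /m; have : 0 < e * k by rewrite mulr_gt0.
nra.
Qed.

(** The equation is given only before time [T]; the final time is reached by continuity from the
    left. *)
Lemma sol_bound (s M t : R) : s != 0 -> 0 <= M ->
  (forall x, s * f0 x <= M) -> 0 <= t <= T -> forall x, s * f t x <= M.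
Proof.
move=> s0 M0 f0M /andP[t0 tT] x.
move: tT; rewrite le_eqVlt => /orP[/eqP tE|tT]; last first.
  by apply: sol_bound_lt => //; rewrite t0.
move: t0; rewrite le_eqVlt => /orP[/eqP<-|t0].
  by rewrite (sol_initial f_sol).
have cf : f r x @[r --> t^'-] --> f t x.
  have := sol_continuous f_sol => /subspace_continuousP/(_ (t, x)).
  have Atx : (`[0, T] `*` setT) (t, x) by split => //=; rewrite in_itv /=; lra.
  move=> /(_ Atx) c.
  have c2 : (r, x) @[r --> t^'-] -->
      within (`[0, T] `*` [set: R]) (nbhs ((t, x) : R * R)).
    have c2 : (r, x) @[r --> t^'-] --> ((t, x) : R * R).
      have ci : (fun r : R => r) @ t^'- --> t by exact: cvg_at_left_filter.
      exact: (cvg_pair ci (cvg_cst x)).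
    move=> B /c2 hB.
    have {}hB : \forall r \near t^'-, r \in `[0, T] /\ True -> B (r, x) by exact: hB.
    change (\forall r \near t^'-, B (r, x)); near=> r.
    suff : r \in `[0, T] /\ True by near: r.
    split => //; rewrite in_itv /= -tE; apply/andP; split.
      by near: r; apply: nbhs_left_ge.
    by near: r; exact: nbhs_left_le.
  exact: (cvg_comp _ _ c2 c).
have : s * f r x @[r --> t^'-] --> s * f t x by apply: cvgM => //; exact: cvg_cst.
move=> c; apply: (cvgr_to_le c); near=> r.
apply: sol_bound_lt => //; apply/andP; split.
  by near: r; apply: nbhs_left_ge.
by rewrite -tE; near: r; exact: nbhs_left_lt.
Unshelve. all: by end_near. Qed.

End maximum_principle.

(** * Suprema, essential suprema and the conclusion *)

Section suprema.
Context {R : realType}.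
Implicit Types u : R -> R.

(** The set where [L < |u|] is open: if not empty, it contains a ball, of positive measure. *)
Lemma ae_continuous_le u (L : \bar R) : continuous u ->
  {ae (@lebesgue_measure R), forall x, (`|u x|%:E <= L)%E} ->
  forall x, (`|u x|%:E <= L)%E.
Proof.
move=> cu [B [mB B0 sub]] x; rewrite leNgt; apply/negP => Lx.
have : \forall y \near x, (L < `|u y|%:E)%E.
  case: L Lx {sub} => [l| |] //; rewrite ?lte_fin => Lx.
    have c : `|u y| @[y --> x] --> `|u x| by exact: continuous_fct_norm.
    exact: (cvgr_gt _ c).
  by apply/nbhs_ballP; exists 1 => //= y _; exact: ltNyr.
move=> /nbhs_ballP[d /= d0 hd].
have : (lebesgue_measure (ball x d) <= lebesgue_measure B)%E.
  apply: le_measure; rewrite ?inE //; first exact: measurable_realfun.measurable_ball.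
  move=> y /hd; rewrite ltNge => /negP h; apply: sub => /=; exact: h.
rewrite B0 lebesgue_measure_ball; last exact: ltW.
by rewrite lee_fin; lra.
Qed.

Lemma Linf_esssup u : Linf u = ess_sup_inf.ess_sup (@lebesgue_measure R)
  (EFin \o (fun x => `|u x|)).
Proof.
(* The norm is an essential supremum only on a space of positive measure, as a unit ball
   certifies. *)
rewrite /Linf unlock ifT //.
apply: (@lt_le_trans _ _ (lebesgue_measure (ball (0 : R) 1))).
  by rewrite lebesgue_measure_ball // lte_fin.
by apply: le_measure; rewrite ?inE //; exact: measurable_realfun.measurable_ball.
Qed.

Lemma norm_le_Linf u x : continuous u -> (`|u x|%:E <= Linf u)%E.
Proof.
move=> cu; rewrite Linf_esssup; apply: ae_continuous_le => //.
exact: ess_sup_inf.ess_sup_ge.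
Qed.

Lemma Linf_le u (M : \bar R) : (forall x, (`|u x|%:E <= M)%E) -> (Linf u <= M)%E.
Proof. by move=> uM; rewrite Linf_esssup; exact: ess_sup_inf.ess_sup_ler. Qed.

(** Supplies the sign of [M] on which the nonvanishing of [f] at the extremum rests. *)
Lemma mean0_bound_ge0 u M : continuous u -> torus_int u = 0 ->
  (forall x, u x <= M) -> 0 <= M.
Proof.
move=> cu u0 uM.
have := le_torus_int cu (@continuous_fct_cst R M) uM.
by rewrite u0 torus_int_cst pmulr_lge0 //; have := @pi_gt0 R; lra.
Qed.

Lemma sol_space_continuous (T : R) f0 (f : R -> R -> R) t :
  is_solution T f0 f -> 0 <= t <= T -> continuous (f t).
Proof.
move=> f_sol tT x.
have := sol_continuous f_sol => /subspace_continuousP/(_ (t, x)).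
have Atx : (`[0, T] `*` setT) (t, x) by split => //=; rewrite in_itv.
move=> /(_ Atx) c.
have c2 : (t, y) @[y --> x] -->
    within (`[0, T] `*` [set: R]) (nbhs ((t, x) : R * R)).
  have ci : (fun y : R => y) @ x --> x by [].
  move=> B /(cvg_pair (cvg_cst t) ci) hB.
  have {}hB : \forall y \near x, t \in `[0, T] /\ True -> B (t, y) by exact: hB.
  by apply: filterS hB => y; apply; split => //; rewrite in_itv.
exact: (cvg_comp _ _ c2 c).
Qed.

End suprema.

Theorem proposition2p2 (R : realType) (T : R) (f0 : R -> R) (f : R -> R -> R)
    (T_gt0 : 0 < T) (f_sol : is_solution T f0 f)
    (f_wiener : (ereal_sup [set wiener1 (f t) | t in `[0%R, T]] <= 1)%E) :
  [/\ (ereal_sup [set tmax (f t) | t in `[0%R, T]] <= tmax f0)%E,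
      (ereal_inf [set tmin (f t) | t in `[0%R, T]] >= tmin f0)%E &
      (ereal_sup [set Linf (f t) | t in `[0%R, T]] <= Linf f0)%E].
Proof.
have w1 t : 0 <= t <= T -> (wiener1 (f t) <= 1)%E.
  move=> tT; apply: le_trans f_wiener; apply: ereal_sup_ubound.
  by exists t => //=; rewrite in_itv.
have T0 : (0 : R) <= 0 <= T by rewrite lexx ltW.
have cf0 : continuous f0.
  by rewrite -(sol_initial f_sol); exact: sol_space_continuous f_sol T0.
have Jf0 : torus_int f0 = 0.
  by rewrite -[in LHS](sol_initial f_sol); exact: sol_mean0 f_sol _ T0.
have upper M : (forall x, f0 x <= M) ->
    forall t, 0 <= t <= T -> forall x, f t x <= M.
  move=> f0M t tT x; rewrite -[f t x]mul1r.
  apply: (sol_bound f_sol w1) => //; first exact: mean0_bound_ge0 cf0 Jf0 f0M.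
  by move=> y; rewrite mul1r.
have lower M : (forall x, M <= f0 x) ->
    forall t, 0 <= t <= T -> forall x, M <= f t x.
  move=> f0M t tT x; rewrite -lerN2 -[- f t x]mulN1r.
  have f0N y : - f0 y <= - M by rewrite lerN2.
  apply: (sol_bound f_sol w1) => //.
  - apply: mean0_bound_ge0 (continuous_fctN cf0) _ f0N.
    by rewrite torus_intN // Jf0 oppr0.
  - by move=> y; rewrite mulN1r.
split.
- apply: ge_ereal_sup => _ [t /= + <-]; rewrite in_itv /= => tT.
  apply: ge_ereal_sup => _ [x _ <-] /=.
  have ub y : ((f0 y)%:E <= tmax f0)%E by apply: ereal_sup_ubound; exists y.
  (* The bound [+oo] is trivial and [-oo] contradicts the value at 0. *)
  move: ub; case: (tmax f0) => [M| |] ub; last by have := ub 0.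
    by rewrite lee_fin; apply: upper => // y; rewrite -lee_fin.
  by rewrite leey.
- apply: le_ereal_inf_tmp => _ [t /= + <-]; rewrite in_itv /= => tT.
  apply: le_ereal_inf_tmp => _ [x _ <-] /=.
  have lb y : (tmin f0 <= (f0 y)%:E)%E by apply: ereal_inf_lbound; exists y.
  move: lb; case: (tmin f0) => [M| |] lb; first last.
  + by rewrite leNye.
  + by have := lb 0.
  by rewrite lee_fin; apply: lower => // y; rewrite -lee_fin.
- apply: ge_ereal_sup => _ [t /= + <-]; rewrite in_itv /= => tT.
  apply: Linf_le => x.
  have bd y := norm_le_Linf y cf0.
  move: bd; case: (Linf f0) => [M| |] bd; last by have := bd 0.
    rewrite lee_fin ler_norml; have f0M y : - M <= f0 y <= M.
      by rewrite -ler_norml -lee_fin.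
    by rewrite lower ?upper // => y; have /andP[] := f0M y.
  by rewrite leey.
Qed.
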